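(* Let $(d_k)$ and $(N_k)$ be sequences of natural numbers such that $(d_k)$ is lacunary and $\sum_k\frac{d_k}{N_{k+a}}<\infty$ for some $a$. Then there is a constant $C\ge1$ such that for every $n$ and all trigonometric polynomials $\varphi_1,\dots,\varphi_n\in H^1(\mathbb{T})$ with $\varphi_k$ being $\frac{2\pi}{N_k}$-periodic and $\deg\varphi_k\le d_k$, \[C^{-1}\|(\varphi_k)_{k=1}^n\|_{\mathrm{ind}}\le\|(\varphi_k)_{k=1}^n\|_{L^1(\ell^2)}\le C\|(\varphi_k)_{k=1}^n\|_{\mathrm{ind}}.\]
   Context: $\mathbb{T}=\mathbb{R}/2\pi\mathbb{Z}$ with normalized Lebesgue measure $\mu$; $H^1(\mathbb{T})$ is the closed span in $L^1(\mathbb{T})$ of $e^{ijt}$, $j\ge0$. $(d_k)$ lacunary means $\inf_kd_{k+1}/d_k>1$. No divisibility relation between the $N_k$ is assumed. $\|(g_k)\|_{L^1(\ell^2)}=\int_{\mathbb{T}}(\sum_k|g_k|^2)^{1/2}d\mu$ and $\|(g_k)\|_{\mathrm{ind}}=\int_{\mathbb{T}^n}(\sum_k|g_k(t_k)|^2)^{1/2}d\mu(t_1)\cdots d\mu(t_n)$. *)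

(* Defs.v *)
From Stdlib Require Import Reals.
From Coquelicot Require Export Coquelicot.
Export Reals.
Open Scope R_scope.

Fixpoint sumR (n : nat) (f : nat -> R) : R :=
  match n with
  | O => 0
  | S m => sumR m f + f m
  end.

(* An analytic trigonometric polynomial of degree <= d,
   phi(t) = sum_{j=0}^{d} (a j + i b j) e^{i j t},
   given by its real and imaginary parts. *)
Definition trig_re (a b : nat -> R) (d : nat) (t : R) : R :=
  sumR (S d) (fun j => a j * cos (INR j * t) - b j * sin (INR j * t)).
Definition trig_im (a b : nat -> R) (d : nat) (t : R) : R :=
  sumR (S d) (fun j => a j * sin (INR j * t) + b j * cos (INR j * t)).
Definition trig_abs (a b : nat -> R) (d : nat) (t : R) : R :=
  sqrt (trig_re a b d t ^ 2 + trig_im a b d t ^ 2).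

Definition trig_periodic (a b : nat -> R) (d : nat) (p : R) : Prop :=
  forall t, trig_re a b d (t + p) = trig_re a b d t /\
            trig_im a b d (t + p) = trig_im a b d t.

Definition lacunary (d : nat -> nat) : Prop :=
  (forall k, (0 < d k)%nat) /\
  exists q, 1 < q /\ forall k, q * INR (d k) <= INR (d (S k)).

Definition Tint (f : R -> R) : R := RInt f 0 (2 * PI) / (2 * PI).

Definition upd (t : nat -> R) (m : nat) (s : R) : nat -> R :=
  fun i => if Nat.eqb i m then s else t i.

Fixpoint Tint_iter (m : nat) (F : (nat -> R) -> R) : R :=
  match m with
  | O => F (fun _ => 0)
  | S m' => Tint (fun s => Tint_iter m' (fun t => F (upd t m' s)))
  end.

Definition norm_L1l2 (n : nat) (a b : nat -> nat -> R) (d : nat -> nat) : R :=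
  Tint (fun t => sqrt (sumR n (fun k => trig_abs (a k) (b k) (d k) t ^ 2))).

Definition norm_ind (n : nat) (a b : nat -> nat -> R) (d : nat -> nat) : R :=
  Tint_iter n (fun t => sqrt (sumR n (fun k => trig_abs (a k) (b k) (d k) (t k) ^ 2))).

(* Main.v *)
Require Import Defs.
From Stdlib Require Import Reals ZArith Lra Lia Psatz FunctionalExtensionality.
From Coquelicot Require Import Coquelicot.
Open Scope R_scope.

(** Replace the independent variables [t_0, t_1, ...] by a common one, one at a time.
    If [G = (phi_0, ..., phi_(m-1))] has degree at most [D] and [phi_m] has period
    [h = 2 pi / N], then evaluating [phi_m] at the variable of [G] instead of an
    independent one changes the norm by at most
    [sup_{0 <= x <= h} || G(. + x) - G ||_1 <= h D || G ||_1],
    so by a factor in [[(1 + h D)^-1, 1 + h D]].  The last estimate is Bernstein's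
    inequality in [L^1(l^2)]; for analytic polynomials it follows from writing [G'] as a
    combination of translates of [G] with Fejer kernel weights of total mass [D].
    To have [D = d_(m-a)] rather than [d_(m-1)], the argument is applied separately to
    each residue class of indices modulo [a + 1]; the product of the factors
    [1 + 2 pi d_(m-a) / N_m] converges. *)

(** * Finite sums *)

(** Analyticity enters through the identity [j = D - |D - j|] for [0 <= j <= D]: up to a modulation
    by frequency [D], differentiation acts on the frequencies [0, ..., D] as a Fejer multiplier. The
    Fejer kernel is positive, so its total mass is its zeroth coefficient, here [D]. The weights are
    scalars acting on all components at once, so the estimate holds for vectors with the same
    constant. Sampling the kernel at [2 D] points turns the convolution into a finite sum. The
    decoupling error is measured by the norm of [G] alone. Both the coupled and the decoupled norm
    dominate that of [G], so one additive estimate gives a factor in either direction. Components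
    whose variables are already independent enter only as a constant [c] under the square root;
    every estimate is therefore proved uniformly in [c >= 0]. The hypothesis controls
    [d_(m-a) / N_m] and not [d_(m-1) / N_m], whence the residue classes. Putting them together again
    costs a factor [a + 1], because the [l^2] norm lies between the norm of one class and the sum of
    the norms of all classes. *)

Lemma sumR_ext (n : nat) (f g : nat -> R) :
  (forall k, (k < n)%nat -> f k = g k) -> sumR n f = sumR n g.
Proof.
  induction n as [|n IH]; intros H; simpl; [easy|].
  rewrite IH, H; auto; lia.
Qed.

Lemma sumR_plus (n : nat) (f g : nat -> R) :
  sumR n (fun k => f k + g k) = sumR n f + sumR n g.
Proof. induction n as [|n IH]; simpl; [lra|rewrite IH; lra]. Qed.

Lemma sumR_scal (n : nat) (c : R) (f : nat -> R) :
  sumR n (fun k => c * f k) = c * sumR n f.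
Proof. induction n as [|n IH]; simpl; [lra|rewrite IH; lra]. Qed.

Lemma sumR_zero (n : nat) : sumR n (fun _ => 0) = 0.
Proof. induction n as [|n IH]; simpl; lra. Qed.

Lemma sumR_const (n : nat) (c : R) : sumR n (fun _ => c) = INR n * c.
Proof.
  induction n as [|n IH]; [simpl; lra|].
  rewrite S_INR; simpl sumR; rewrite IH; lra.
Qed.

Lemma sumR_swap (n m : nat) (f : nat -> nat -> R) :
  sumR n (fun i => sumR m (f i)) = sumR m (fun j => sumR n (fun i => f i j)).
Proof.
  induction n as [|n IH]; simpl; [now rewrite sumR_zero|].
  rewrite IH, sumR_plus; lra.
Qed.

Lemma sumR_le (n : nat) (f g : nat -> R) :
  (forall k, (k < n)%nat -> f k <= g k) -> sumR n f <= sumR n g.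
Proof.
  induction n as [|n IH]; intros H; simpl; [lra|].
  apply Rplus_le_compat; [apply IH; intros; apply H|apply H]; lia.
Qed.

Lemma sumR_nonneg (n : nat) (f : nat -> R) :
  (forall k, (k < n)%nat -> 0 <= f k) -> 0 <= sumR n f.
Proof.
  intros H; rewrite <- (sumR_zero n); now apply sumR_le.
Qed.

Lemma sumR_continuous (U : UniformSpace) (n : nat) (f : nat -> U -> R) (x : U) :
  (forall k, (k < n)%nat -> continuous (f k) x) ->
  continuous (fun y => sumR n (fun k => f k y)) x.
Proof.
  induction n as [|n IH]; intros H; simpl; [apply continuous_const|].
  apply (continuous_plus (fun y => sumR n (fun k => f k y)) (f n));
    [apply IH; intros; apply H|apply H]; lia.
Qed.

Lemma sumR_is_derive (n : nat) (f : nat -> R -> R) (l : nat -> R) (x : R) :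
  (forall k, (k < n)%nat -> is_derive (f k) x (l k)) ->
  is_derive (fun y => sumR n (fun k => f k y)) x (sumR n l).
Proof.
  induction n as [|n IH]; intros H; simpl; [apply @is_derive_const|].
  apply (is_derive_plus (fun y => sumR n (fun k => f k y)) (f n));
    [apply IH; intros; apply H|apply H]; lia.
Qed.

Lemma sumR_cauchy_schwarz (n : nat) (x y : nat -> R) :
  sumR n (fun k => x k * y k) ^ 2
    <= sumR n (fun k => x k ^ 2) * sumR n (fun k => y k ^ 2).
Proof.
  induction n as [|n IH]; [simpl; lra|].
  cbn [sumR].
  set (s := sumR n (fun k => x k * y k)) in *.
  set (a := sumR n (fun k => x k ^ 2)) in *.
  set (b := sumR n (fun k => y k ^ 2)) in *.
  assert (Ha : 0 <= a) by (apply sumR_nonneg; intros; apply pow2_ge_0).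
  assert (Hb : 0 <= b) by (apply sumR_nonneg; intros; apply pow2_ge_0).
  (* AM-GM: [(2 s x y)^2 <= 4 a b x^2 y^2 <= (a y^2 + b x^2)^2] *)
  assert (H : 2 * s * (x n * y n) <= a * y n ^ 2 + b * x n ^ 2).
  { apply Rsqr_incr_0_var; [unfold Rsqr|].
    - pose proof (Rmult_le_compat_r _ _ _ (pow2_ge_0 (x n * y n)) IH).
      pose proof (pow2_ge_0 (a * y n ^ 2 - b * x n ^ 2)).
      lra.
    - apply Rplus_le_le_0_compat; apply Rmult_le_pos; auto; apply pow2_ge_0. }
  lra.
Qed.

(** * Riemann integrals of continuous functions *)

Lemma ex_RInt_cont (f : R -> R) (a b : R) :
  (forall x, continuous f x) -> ex_RInt f a b.
Proof. intros H; apply (@ex_RInt_continuous R_CompleteNormedModule); intros; apply H. Qed.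

Lemma RInt_sumR (n : nat) (f : nat -> R -> R) (a b : R) :
  (forall k x, (k < n)%nat -> continuous (f k) x) ->
  RInt (fun x => sumR n (fun k => f k x)) a b = sumR n (fun k => RInt (f k) a b).
Proof.
  induction n as [|n IH]; intros H; simpl.
  - rewrite RInt_const; unfold scal; simpl; unfold mult; simpl; ring.
  - rewrite <- IH by (intros; apply H; lia).
    apply (RInt_plus (fun x => sumR n (fun k => f k x)) (f n));
      apply ex_RInt_cont; intros; [apply sumR_continuous; intros|]; apply H; lia.
Qed.

Lemma continuous_slice_l (f : R -> R -> R) (x y : R) :
  continuous (fun z : R * R => f (fst z) (snd z)) (x, y) ->
  continuous (fun u => f u y) x.
Proof.
  intros H.
  apply (continuous_comp (fun u => (u, y)) (fun z : R * R => f (fst z) (snd z))); auto.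
  apply (continuous_comp_2 (fun u => u) (fun _ => y) (fun u v => (u, v)));
    [apply continuous_id|apply continuous_const|].
  apply (continuous_ext (fun z : R * R => z)); [now intros []|apply continuous_id].
Qed.

Lemma continuous_slice_r (f : R -> R -> R) (x y : R) :
  continuous (fun z : R * R => f (fst z) (snd z)) (x, y) ->
  continuous (f x) y.
Proof.
  intros H.
  apply (continuous_comp (fun v => (x, v)) (fun z : R * R => f (fst z) (snd z))); auto.
  apply (continuous_comp_2 (fun _ => x) (fun v => v) (fun u v => (u, v)));
    [apply continuous_const|apply continuous_id|].
  apply (continuous_ext (fun z : R * R => z)); [now intros []|apply continuous_id].
Qed.

Lemma continuous_RInt_param (f : R -> R -> R) (c d x : R) :
  c <= d ->
  (forall z : R * R, continuous (fun z => f (fst z) (snd z)) z) ->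
  continuous (fun u => RInt (f u) c d) x.
Proof.
  intros Hcd H.
  apply filterlim_locally; intros eps.
  (* The [+ 1] covers the degenerate interval [c = d]. *)
  assert (He : 0 < eps / (d - c + 1)) by (apply Rdiv_lt_0_compat; [apply eps|lra]).
  destruct (uniform_continuity_2d_1d' f c d x) with (eps := mkposreal _ He) as [del Hd].
  { intros y _; apply continuity_2d_pt_filterlim, H. }
  exists del; intros u Hu.
  change (Rabs (RInt (f u) c d - RInt (f x) c d) < eps).
  assert (Hi : forall u, ex_RInt (f u) c d)
    by (intros; apply ex_RInt_cont; intros; apply continuous_slice_r, H).
  change (Rabs (minus (RInt (f u) c d) (RInt (f x) c d)) < eps).
  rewrite <- RInt_minus by apply Hi.
  apply Rle_lt_trans with ((d - c) * (eps / (d - c + 1))).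
  - apply abs_RInt_le_const; [easy| |].
    + now apply @ex_RInt_minus.
    + intros t Ht; left.
      change (Rabs (u - x) < del) in Hu.
      apply Rabs_lt_between in Hu.
      apply (Hd t x t u); try lra.
      rewrite Rminus_diag, Rabs_R0; apply del.
  - pose proof (cond_pos eps).
    apply Rmult_lt_reg_r with (d - c + 1); [lra|].
    replace ((d - c) * (eps / (d - c + 1)) * (d - c + 1)) with ((d - c) * eps)
      by (field; lra).
    nra.
Qed.

(* Both sides, as functions of [b], vanish at [b = a] and have the same derivative. *)
Lemma RInt_fubini (f : R -> R -> R) (a b c d : R) :
  a < b -> c <= d ->
  (forall z : R * R, continuous (fun z => f (fst z) (snd z)) z) ->
  RInt (fun x => RInt (f x) c d) a b = RInt (fun y => RInt (fun x => f x y) a b) c d.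
Proof.
  intros Hab Hcd H.
  assert (Hswap : forall z : R * R, continuous (fun z => f (snd z) (fst z)) z).
  { intros [u v].
    apply (continuous_comp_2 snd fst (fun p q => f p q) (u, v));
      [apply continuous_snd|apply continuous_fst|apply H]. }
  assert (Hl : forall x y, continuous (fun u => f u y) x)
    by (intros; apply continuous_slice_l, H).
  assert (HD : forall x y, is_derive (fun b => RInt (fun u => f u y) a b) x (f x y)).
  { intros x y; apply (is_derive_RInt (fun u => f u y) _ a); [|apply Hl].
    apply filter_forall; intros; apply (@RInt_correct R_CompleteNormedModule), ex_RInt_cont.
    intros; apply Hl. }
  set (Phi := fun b => RInt (fun x => RInt (f x) c d) a b).
  set (Psi := fun b => RInt (fun y => RInt (fun x => f x y) a b) c d).
  enough (E : minus (Phi a) (Psi a) = minus (Phi b) (Psi b)).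
  { change (Phi a - Psi a = Phi b - Psi b) in E.
    assert (Phi a = 0) by apply (@RInt_point R_CompleteNormedModule).
    assert (Psi a = 0).
    { unfold Psi; rewrite (RInt_ext _ (fun _ => 0))
        by (intros; apply (@RInt_point R_CompleteNormedModule)).
      rewrite RInt_const; apply Rmult_0_r. }
    change (Phi b = Psi b); lra. }
  apply (eq_is_derive (fun b => minus (Phi b) (Psi b))); [|exact Hab].
  intros t Ht.
  enough (HE : is_derive (fun b => minus (Phi b) (Psi b)) t
                 (minus (RInt (f t) c d : R_NormedModule) (RInt (f t) c d)))
    by (now rewrite minus_eq_zero in HE).
  apply (is_derive_minus (V := R_NormedModule) Phi Psi).
  - assert (Hc : forall x, continuous (fun u => RInt (f u) c d) x)
      by (intros; now apply continuous_RInt_param).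
    apply (is_derive_RInt (fun x => RInt (f x) c d) _ a); [|apply Hc].
    apply filter_forall; intros; apply (@RInt_correct R_CompleteNormedModule), ex_RInt_cont, Hc.
  - replace (RInt (f t) c d)
      with (RInt (fun y => Derive (fun b => RInt (fun x => f x y) a b) t) c d)
      by (apply RInt_ext; intros; apply is_derive_unique, HD).
    apply is_derive_RInt_param.
    + apply filter_forall; intros x y _; exists (f x y); apply HD.
    + intros y _; apply (continuity_2d_pt_ext f).
      * intros; symmetry; apply is_derive_unique, HD.
      * apply continuity_2d_pt_filterlim, H.
    + apply filter_forall; intros x.
      apply ex_RInt_cont; intros y.
      destruct (Rle_dec a x) as [Hax|Hax].
      * now apply (continuous_RInt_param (fun v u => f u v)).
      * apply (continuous_ext (fun y => opp (RInt (fun u => f u y) x a))).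
        { intros; apply opp_RInt_swap, ex_RInt_cont; intros; apply Hl. }
        apply @continuous_opp.
        apply (continuous_RInt_param (fun v u => f u v)); [lra|easy].
Qed.

(** * Averages over the circle *)

Lemma RInt_shift (f : R -> R) (a b u : R) :
  (forall x, continuous f x) ->
  RInt (fun s => f (s + u)) a b = RInt f (a + u) (b + u).
Proof.
  intros Hf.
  pose proof (RInt_comp_lin f 1 u a b) as H; rewrite !Rmult_1_l in H.
  rewrite <- H by now apply ex_RInt_cont.
  apply RInt_ext; intros x _.
  unfold scal; simpl; unfold mult; simpl.
  now rewrite !Rmult_1_l.
Qed.

Lemma RInt_periodic_shift (f : R -> R) (p u : R) :
  (forall x, continuous f x) -> (forall x, f (x + p) = f x) ->
  RInt (fun s => f (s + u)) 0 p = RInt f 0 p.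
Proof.
  intros Hf Hp.
  rewrite RInt_shift, Rplus_0_l by easy.
  assert (Hi : forall a b, ex_RInt f a b) by (intros; now apply ex_RInt_cont).
  assert (E1 : RInt f u 0 + RInt f 0 (p + u) = RInt f u (p + u))
    by (apply (RInt_Chasles f); apply Hi).
  assert (E2 : RInt f 0 p + RInt f p (p + u) = RInt f 0 (p + u))
    by (apply (RInt_Chasles f); apply Hi).
  assert (E3 : RInt f u 0 + RInt f 0 u = RInt f u u)
    by (apply (RInt_Chasles f); apply Hi).
  assert (E4 : RInt f u u = 0) by apply (@RInt_point R_CompleteNormedModule).
  assert (E5 : RInt f p (p + u) = RInt f 0 u).
  { transitivity (RInt (fun s => f (s + p)) 0 u).
    - now rewrite (RInt_shift f 0 u p), Rplus_0_l, (Rplus_comm u).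
    - apply RInt_ext; intros; apply Hp. }
  lra.
Qed.

Lemma two_PI_pos : 0 < 2 * PI.
Proof. pose proof PI_RGT_0; lra. Qed.

Lemma Tint_ext (f g : R -> R) : (forall x, f x = g x) -> Tint f = Tint g.
Proof. intros H; unfold Tint; f_equal; apply RInt_ext; intros; apply H. Qed.

Lemma Tint_const (c : R) : Tint (fun _ => c) = c.
Proof.
  pose proof two_PI_pos.
  unfold Tint; rewrite RInt_const; unfold scal; simpl; unfold mult; simpl.
  field; lra.
Qed.

Lemma Tint_le (f g : R -> R) :
  (forall x, continuous f x) -> (forall x, continuous g x) ->
  (forall x, f x <= g x) -> Tint f <= Tint g.
Proof.
  intros Hf Hg H; pose proof two_PI_pos; unfold Tint, Rdiv.
  apply Rmult_le_compat_r; [left; now apply Rinv_0_lt_compat|].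
  apply RInt_le; auto using ex_RInt_cont; lra.
Qed.

Lemma Tint_scal (c : R) (f : R -> R) :
  (forall x, continuous f x) -> Tint (fun x => c * f x) = c * Tint f.
Proof.
  intros Hf; unfold Tint.
  assert (E : RInt (fun x => c * f x) 0 (2 * PI) = c * RInt f 0 (2 * PI))
    by (apply (RInt_scal f); now apply ex_RInt_cont).
  rewrite E; unfold Rdiv; ring.
Qed.

Lemma Tint_minus (f g : R -> R) :
  (forall x, continuous f x) -> (forall x, continuous g x) ->
  Tint (fun x => f x - g x) = Tint f - Tint g.
Proof.
  intros Hf Hg; unfold Tint.
  assert (E : RInt (fun x => f x - g x) 0 (2 * PI)
              = RInt f 0 (2 * PI) - RInt g 0 (2 * PI))
    by (apply (RInt_minus f g); now apply ex_RInt_cont).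
  rewrite E; unfold Rdiv; ring.
Qed.

Lemma Tint_sumR (n : nat) (f : nat -> R -> R) :
  (forall k x, (k < n)%nat -> continuous (f k) x) ->
  Tint (fun x => sumR n (fun k => f k x)) = sumR n (fun k => Tint (f k)).
Proof.
  intros Hf; unfold Tint; rewrite RInt_sumR by easy.
  unfold Rdiv; rewrite Rmult_comm, <- sumR_scal.
  apply sumR_ext; intros; apply Rmult_comm.
Qed.

Lemma Tint_shift (f : R -> R) (u : R) :
  (forall x, continuous f x) -> (forall x, f (x + 2 * PI) = f x) ->
  Tint (fun s => f (s + u)) = Tint f.
Proof. intros; unfold Tint; now rewrite RInt_periodic_shift. Qed.

Lemma Tint_nonneg (f : R -> R) :
  (forall x, continuous f x) -> (forall x, 0 <= f x) -> 0 <= Tint f.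
Proof.
  intros; rewrite <- (Tint_const 0); apply Tint_le; auto.
  intros; apply continuous_const.
Qed.

Lemma Tint_abs_minus_le (f g h : R -> R) :
  (forall x, continuous f x) -> (forall x, continuous g x) ->
  (forall x, continuous h x) ->
  (forall x, Rabs (f x - g x) <= h x) -> Rabs (Tint f - Tint g) <= Tint h.
Proof.
  intros Hf Hg Hh H.
  assert (Hd : forall x, continuous (fun x => f x - g x) x)
    by (intros; now apply (continuous_minus f g)).
  rewrite <- Tint_minus by easy.
  assert (Hb : forall x, - h x <= f x - g x <= h x)
    by (intros; apply Rabs_le_between, H).
  apply Rabs_le; split.
  - replace (- Tint h) with (Tint (fun x => -1 * h x)) by (rewrite Tint_scal; auto; ring).
    apply Tint_le; auto.
    + intros; now apply (continuous_scal_r (-1) h).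
    + intros x; specialize (Hb x); lra.
  - apply Tint_le; auto; intros; apply Hb.
Qed.

Lemma Tint_swap (f : R -> R -> R) :
  (forall z : R * R, continuous (fun z => f (fst z) (snd z)) z) ->
  Tint (fun x => Tint (f x)) = Tint (fun y => Tint (fun x => f x y)).
Proof.
  intros H; pose proof two_PI_pos as HP.
  assert (H' : forall z : R * R, continuous (fun z => f (snd z) (fst z)) z).
  { intros [u v].
    apply (continuous_comp_2 snd fst (fun p q => f p q) (u, v));
      [apply continuous_snd|apply continuous_fst|apply H]. }
  assert (E : forall g : R -> R -> R,
    (forall z : R * R, continuous (fun z => g (fst z) (snd z)) z) ->
    Tint (fun x => Tint (g x))
    = / (2 * PI) * / (2 * PI) * RInt (fun x => RInt (g x) 0 (2 * PI)) 0 (2 * PI)).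
  { intros g Hg.
    rewrite (Tint_ext _ (fun x => / (2 * PI) * RInt (g x) 0 (2 * PI)))
      by (intros; apply Rmult_comm).
    rewrite Tint_scal by (intros; apply continuous_RInt_param; [lra|easy]).
    rewrite Rmult_assoc; f_equal; apply Rmult_comm. }
  rewrite E, (E (fun y x => f x y)) by easy; f_equal.
  apply RInt_fubini; auto; lra.
Qed.

Lemma Tint_continuous (f : R -> R -> R) (x : R) :
  (forall z : R * R, continuous (fun z => f (fst z) (snd z)) z) ->
  continuous (fun u => Tint (f u)) x.
Proof.
  intros H; pose proof two_PI_pos.
  apply (continuous_ext (fun u => scal (/ (2 * PI)) (RInt (f u) 0 (2 * PI)))).
  { intros; apply Rmult_comm. }
  apply (continuous_scal_r (/ (2 * PI)) (fun u => RInt (f u) 0 (2 * PI))).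
  apply continuous_RInt_param; [lra|easy].
Qed.

(** * A discrete Bernstein formula *)

(** For [i < 2 D] these are the arguments of the [2 D]-th roots of unity. The frequencies
    [p + n - q] with [p, q < D] and [n <= D] lie strictly between [- 2 D] and [2 D], so summing over
    this many nodes kills all of them except zero. *)
Definition node (D i : nat) : R := INR i * (PI / INR D).

(** Half the Fejer kernel at the node, written as a squared modulus
    [|sum_(p<D) e^(i p th)|^2 / (2 D)] so that its sign is evident. The normalization makes the
    total over the [2 D] nodes equal to [D]. *)
Definition fejer_weight (D i : nat) : R :=
  (sumR D (fun p => cos (INR p * node D i)) ^ 2
   + sumR D (fun p => sin (INR p * node D i)) ^ 2) / (2 * INR D).

(** The factor [2 sin (x / 2)] turns each term into a difference of values at half steps; left
    undivided, the identity holds for every [x]. *)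
Lemma sumR_cos_telescope (M : nat) (x : R) :
  2 * sin (x / 2) * sumR M (fun i => cos (INR i * x))
  = sin (INR M * x - x / 2) + sin (x / 2).
Proof.
  induction M as [|M IH].
  - simpl; replace (0 * x - x / 2) with (- (x / 2)) by ring; rewrite sin_neg; ring.
  - simpl sumR; rewrite Rmult_plus_distr_l, IH, S_INR.
    replace ((INR M + 1) * x - x / 2) with (INR M * x + x / 2) by field.
    rewrite sin_plus, sin_minus; ring.
Qed.

Lemma sumR_sin_telescope (M : nat) (x : R) :
  2 * sin (x / 2) * sumR M (fun i => sin (INR i * x))
  = cos (x / 2) - cos (INR M * x - x / 2).
Proof.
  induction M as [|M IH].
  - simpl; replace (0 * x - x / 2) with (- (x / 2)) by ring; rewrite cos_neg; ring.
  - simpl sumR; rewrite Rmult_plus_distr_l, IH, S_INR.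
    replace ((INR M + 1) * x - x / 2) with (INR M * x + x / 2) by field.
    rewrite cos_plus, cos_minus; ring.
Qed.

Lemma sumR_node_vanish (D k : nat) :
  (0 < k < 2 * D)%nat ->
  sumR (2 * D) (fun i => cos (INR k * node D i)) = 0 /\
  sumR (2 * D) (fun i => sin (INR k * node D i)) = 0.
Proof.
  intros Hk.
  assert (HD : 0 < INR D) by (apply lt_0_INR; lia).
  pose proof PI_RGT_0 as HPI.
  set (x := INR k * (PI / INR D)).
  (* The bounds on [k] put [x / 2 = PI k / (2 D)] inside [(0, PI)], so this factor can be cancelled
     at the end. *)
  assert (Hs : 0 < sin (x / 2)).
  { assert (0 < INR k) by (apply lt_0_INR; lia).
    assert (Hk2 : INR k < 2 * INR D)
      by (rewrite <- (mult_INR 2); apply lt_INR; lia).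
    apply sin_gt_0.
    - unfold x; apply Rdiv_lt_0_compat; [|lra].
      apply Rmult_lt_0_compat; [easy|now apply Rdiv_lt_0_compat].
    - replace (x / 2) with (PI * (INR k / (2 * INR D))) by (unfold x; field; lra).
      rewrite <- (Rmult_1_r PI) at 2; apply Rmult_lt_compat_l; [easy|].
      apply Rlt_div_l; lra. }
  (* After [2 D] steps the phase has made [k] full turns, so the two boundary terms of each
     telescoping sum cancel. *)
  assert (HM : INR (2 * D) * x - x / 2 = - (x / 2) + 2 * INR k * PI).
  { rewrite mult_INR; change (INR 2) with 2; unfold x; field; lra. }
  assert (E : forall i, INR k * node D i = INR i * x)
    by (intros; unfold node, x; ring).
  rewrite (sumR_ext _ _ (fun i => cos (INR i * x))) by (intros; now rewrite E).
  rewrite (sumR_ext _ (fun i => sin _) (fun i => sin (INR i * x)))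
    by (intros; now rewrite E).
  pose proof (sumR_cos_telescope (2 * D) x) as Hc.
  pose proof (sumR_sin_telescope (2 * D) x) as Hsn.
  rewrite HM, sin_period, sin_neg in Hc.
  rewrite HM, cos_period, cos_neg in Hsn.
  split; apply (Rmult_eq_reg_l (2 * sin (x / 2))); lra.
Qed.

(** Discrete orthogonality. The frequency is a difference of reals because it may be negative;
    parity of [cos] and [sin] reduces that case to a natural frequency. *)
Lemma sumR_node (D p n q : nat) :
  (p < D)%nat -> (q < D)%nat -> (n <= D)%nat ->
  sumR (2 * D) (fun i => cos ((INR p + INR n - INR q) * node D i))
    = (if (p + n =? q)%nat then 2 * INR D else 0) /\
  sumR (2 * D) (fun i => sin ((INR p + INR n - INR q) * node D i)) = 0.
Proof.
  intros Hp Hq Hn.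
  destruct (Nat.lt_trichotomy (p + n) q) as [H|[H|H]].
  - assert (E : forall i, (INR p + INR n - INR q) * node D i
                          = - (INR (q - (p + n)) * node D i)).
    { intros; rewrite minus_INR, plus_INR by lia; ring. }
    destruct (sumR_node_vanish D (q - (p + n))) as [Hc Hs]; [lia|].
    rewrite (proj2 (Nat.eqb_neq _ _)) by lia.
    split.
    + rewrite <- Hc; apply sumR_ext; intros; now rewrite E, cos_neg.
    + rewrite (sumR_ext _ _ (fun i => -1 * sin (INR (q - (p + n)) * node D i)))
        by (intros; rewrite E, sin_neg; ring).
      rewrite sumR_scal, Hs; ring.
  - rewrite (proj2 (Nat.eqb_eq _ _)) by easy.
    assert (E : forall i, (INR p + INR n - INR q) * node D i = 0)
      by (intros; rewrite <- H, plus_INR; ring).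
    split.
    + rewrite (sumR_ext _ _ (fun _ => 1)) by (intros; now rewrite E, cos_0).
      rewrite sumR_const, mult_INR; simpl; ring.
    + rewrite (sumR_ext _ _ (fun _ => 0)) by (intros; now rewrite E, sin_0).
      apply sumR_zero.
  - assert (E : forall i, (INR p + INR n - INR q) * node D i
                          = INR (p + n - q) * node D i).
    { intros; rewrite minus_INR, plus_INR by lia; ring. }
    destruct (sumR_node_vanish D (p + n - q)) as [Hc Hs]; [lia|].
    rewrite (proj2 (Nat.eqb_neq _ _)) by lia.
    split.
    + rewrite <- Hc; apply sumR_ext; intros; now rewrite E.
    + rewrite <- Hs; apply sumR_ext; intros; now rewrite E.
Qed.

Lemma sumR_indicator (D n q : nat) (c : R) :
  sumR D (fun p => if (p + n =? q)%nat then c else 0)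
  = if (andb (n <=? q) (q <? D + n))%nat then c else 0.
Proof.
  induction D as [|D IH]; simpl sumR.
  - destruct (Nat.leb_spec n q), (Nat.ltb_spec q (0 + n)); simpl; auto; lia.
  - rewrite IH.
    destruct (Nat.leb_spec n q), (Nat.ltb_spec q (D + n)), (Nat.ltb_spec q (S D + n)),
      (Nat.eqb_spec (D + n) q); simpl; try ring; lia.
Qed.

Lemma sumR_tail_count (D n : nat) (c : R) :
  sumR D (fun q => if (n <=? q)%nat then c else 0) = INR (D - n) * c.
Proof.
  induction D as [|D IH]; [simpl; ring|].
  simpl sumR; rewrite IH.
  destruct (Nat.leb_spec n D).
  - replace (S D - n)%nat with (S (D - n)) by lia; rewrite S_INR; ring.
  - replace (S D - n)%nat with (D - n)%nat by lia; ring.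
Qed.

(** Real and imaginary parts of [|sum_p e^(i p th)|^2 e^(i n th) = sum_(p,q) e^(i (p + n - q) th)],
    divided by [2 D]. *)
Lemma fejer_expand (D n i : nat) :
  fejer_weight D i * cos (INR n * node D i)
    = / (2 * INR D) * sumR D (fun q => sumR D (fun p =>
        cos ((INR p + INR n - INR q) * node D i))) /\
  fejer_weight D i * sin (INR n * node D i)
    = / (2 * INR D) * sumR D (fun q => sumR D (fun p =>
        sin ((INR p + INR n - INR q) * node D i))).
Proof.
  unfold fejer_weight, Rdiv.
  set (t := node D i).
  set (C := sumR D (fun p => cos (INR p * t))).
  set (S := sumR D (fun p => sin (INR p * t))).
  set (c := cos (INR n * t)); set (s := sin (INR n * t)).
  split.
  - rewrite (sumR_ext D (fun q => sumR D _)
      (fun q => (C * c - S * s) * cos (INR q * t) + (S * c + C * s) * sin (INR q * t))).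
    + rewrite sumR_plus, !sumR_scal; fold C S; ring.
    + intros q _.
      rewrite (sumR_ext D _ (fun p =>
        (c * cos (INR q * t) + s * sin (INR q * t)) * cos (INR p * t)
        + (c * sin (INR q * t) - s * cos (INR q * t)) * sin (INR p * t))).
      * rewrite sumR_plus, !sumR_scal; fold C S; ring.
      * intros p _; rewrite Rmult_minus_distr_r, Rmult_plus_distr_r.
        rewrite cos_minus, cos_plus, sin_plus; fold c s; ring.
  - rewrite (sumR_ext D (fun q => sumR D _)
      (fun q => (S * c + C * s) * cos (INR q * t) + (S * s - C * c) * sin (INR q * t))).
    + rewrite sumR_plus, !sumR_scal; fold C S; ring.
    + intros q _.
      rewrite (sumR_ext D _ (fun p =>
        (s * cos (INR q * t) - c * sin (INR q * t)) * cos (INR p * t)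
        + (c * cos (INR q * t) + s * sin (INR q * t)) * sin (INR p * t))).
      * rewrite sumR_plus, !sumR_scal; fold C S; ring.
      * intros p _; rewrite Rmult_minus_distr_r, Rmult_plus_distr_r.
        rewrite sin_minus, cos_plus, sin_plus; fold c s; ring.
Qed.

(** For fixed [q], orthogonality leaves only [p = q - n], which exists exactly when [n <= q]. There
    are [D - n] such [q] below [D], each contributing [2 D / (2 D) = 1]. *)
Lemma fejer_moments (D n : nat) :
  (0 < D)%nat -> (n <= D)%nat ->
  sumR (2 * D) (fun i => fejer_weight D i * cos (INR n * node D i)) = INR (D - n) /\
  sumR (2 * D) (fun i => fejer_weight D i * sin (INR n * node D i)) = 0.
Proof.
  intros HD Hn.
  assert (HD' : 0 < INR D) by now apply lt_0_INR.
  split.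
  - rewrite (sumR_ext _ _ _ (fun i _ => proj1 (fejer_expand D n i))).
    rewrite sumR_scal, sumR_swap.
    rewrite (sumR_ext D _ (fun q => if (n <=? q)%nat then 2 * INR D else 0)).
    + rewrite sumR_tail_count; field; lra.
    + intros q Hq; rewrite sumR_swap.
      rewrite (sumR_ext D _ (fun p => if (p + n =? q)%nat then 2 * INR D else 0))
        by (intros; now apply sumR_node).
      rewrite sumR_indicator, (proj2 (Nat.ltb_lt q (D + n))) by lia.
      now rewrite Bool.andb_true_r.
  - rewrite (sumR_ext _ _ _ (fun i _ => proj2 (fejer_expand D n i))).
    rewrite sumR_scal, sumR_swap.
    rewrite (sumR_ext D _ (fun q => 0)); [rewrite sumR_zero; ring|].
    intros q Hq; rewrite sumR_swap.
    rewrite (sumR_ext D _ (fun p => 0)) by (intros; now apply sumR_node).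
    apply sumR_zero.
Qed.

Lemma fejer_weight_nonneg (D i : nat) : (0 < D)%nat -> 0 <= fejer_weight D i.
Proof.
  intros HD; apply lt_0_INR in HD.
  unfold fejer_weight; apply Rdiv_le_0_compat; [|lra].
  apply Rplus_le_le_0_compat; apply pow2_ge_0.
Qed.

Lemma fejer_weight_sum (D : nat) :
  (0 < D)%nat -> sumR (2 * D) (fejer_weight D) = INR D.
Proof.
  intros HD.
  destruct (fejer_moments D 0 HD) as [H _]; [lia|].
  rewrite Nat.sub_0_r in H; rewrite <- H; apply sumR_ext; intros.
  simpl; rewrite Rmult_0_l, cos_0; ring.
Qed.

(** The moment of order [D - j] is [D - (D - j) = j], the factor that differentiation puts on the
    mode [j]. The vanishing sine moment keeps the phase [y] unchanged. *)
Lemma fejer_mode (D j : nat) (y : R) :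
  (0 < D)%nat -> (j <= D)%nat ->
  sumR (2 * D) (fun i => fejer_weight D i * cos (y + (INR D - INR j) * node D i))
    = INR j * cos y /\
  sumR (2 * D) (fun i => fejer_weight D i * sin (y + (INR D - INR j) * node D i))
    = INR j * sin y.
Proof.
  intros HD Hj.
  destruct (fejer_moments D (D - j) HD) as [Hc Hs]; [lia|].
  replace (D - (D - j))%nat with j in Hc by lia.
  rewrite minus_INR in Hc, Hs by easy.
  split.
  - rewrite (sumR_ext _ _ (fun i =>
      cos y * (fejer_weight D i * cos ((INR D - INR j) * node D i))
      + - sin y * (fejer_weight D i * sin ((INR D - INR j) * node D i))))
      by (intros; rewrite cos_plus; ring).
    rewrite sumR_plus, !sumR_scal, Hc, Hs; ring.
  - rewrite (sumR_ext _ _ (fun i =>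
      sin y * (fejer_weight D i * cos ((INR D - INR j) * node D i))
      + cos y * (fejer_weight D i * sin ((INR D - INR j) * node D i))))
      by (intros; rewrite sin_plus; ring).
    rewrite sumR_plus, !sumR_scal, Hc, Hs; ring.
Qed.

(* With [phi = u + i v] and nodes [th_i], weights [w_i] as above, this says
   [phi'(t) = sum_i w_i (i e^{i D th_i}) phi(t - th_i)]. *)
Definition bernstein_pair (D : nat) (u v : R -> R) : Prop :=
  forall t,
    is_derive u t (sumR (2 * D) (fun i => fejer_weight D i *
      (- sin (INR D * node D i) * u (t - node D i)
       - cos (INR D * node D i) * v (t - node D i)))) /\
    is_derive v t (sumR (2 * D) (fun i => fejer_weight D i *
      (cos (INR D * node D i) * u (t - node D i)
       - sin (INR D * node D i) * v (t - node D i)))).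

(** Serves the components that are replaced by zero outside a residue class. *)
Lemma bernstein_pair_zero (D : nat) : bernstein_pair D (fun _ => 0) (fun _ => 0).
Proof.
  intros t.
  split; rewrite (sumR_ext _ _ (fun _ => 0)) by (intros; ring);
    rewrite sumR_zero; apply @is_derive_const.
Qed.

(** Allowing any [D >= d] lets polynomials of different degrees share the same nodes and weights, as
    the vector estimate requires. *)
Lemma trig_bernstein_pair (a b : nat -> R) (d D : nat) :
  (0 < D)%nat -> (d <= D)%nat ->
  bernstein_pair D (trig_re a b d) (trig_im a b d).
Proof.
  intros HD Hd t.
  assert (Hmode : forall j, (j < S d)%nat ->
    sumR (2 * D) (fun i => fejer_weight D i *
      sin (INR j * t + (INR D - INR j) * node D i)) = INR j * sin (INR j * t) /\
    sumR (2 * D) (fun i => fejer_weight D i *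
      cos (INR j * t + (INR D - INR j) * node D i)) = INR j * cos (INR j * t))
    by (intros; split; apply fejer_mode; lia).
  (* The modulation [e^(i D th)] and the translation by [- th] combine into the phase treated by
     [fejer_mode]. *)
  assert (Harg : forall j i, INR j * t + (INR D - INR j) * node D i
    = INR D * node D i + INR j * (t - node D i)) by (intros; ring).
  split.
  - replace (sumR (2 * D) _) with
      (sumR (S d) (fun j => a j * (- (INR j * sin (INR j * t)))
                            - b j * (INR j * cos (INR j * t)))).
    + unfold trig_re.
      apply (sumR_is_derive (S d)
        (fun j t => a j * cos (INR j * t) - b j * sin (INR j * t))).
      intros j _; auto_derive; [easy|ring].
    + unfold trig_re, trig_im.
      rewrite (sumR_ext (2 * D) _ (fun i => sumR (S d) (fun j =>
        - a j * (fejer_weight D i * sin (INR j * t + (INR D - INR j) * node D i))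
        + - b j * (fejer_weight D i * cos (INR j * t + (INR D - INR j) * node D i))))).
      * rewrite sumR_swap; apply sumR_ext; intros j Hj.
        rewrite sumR_plus, !sumR_scal.
        destruct (Hmode j Hj) as [-> ->]; ring.
      * intros i _; unfold Rminus at 1.
        rewrite <- Ropp_mult_distr_l, <- Ropp_plus_distr, <- !sumR_scal, <- sumR_plus.
        rewrite <- Ropp_mult_distr_r, Ropp_mult_distr_l, <- sumR_scal.
        apply sumR_ext; intros j _.
        rewrite Harg, sin_plus, cos_plus; ring.
  - replace (sumR (2 * D) _) with
      (sumR (S d) (fun j => a j * (INR j * cos (INR j * t))
                            - b j * (INR j * sin (INR j * t)))).
    + unfold trig_im.
      apply (sumR_is_derive (S d)
        (fun j t => a j * sin (INR j * t) + b j * cos (INR j * t))).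
      intros j _; auto_derive; [easy|ring].
    + unfold trig_re, trig_im.
      rewrite (sumR_ext (2 * D) _ (fun i => sumR (S d) (fun j =>
        a j * (fejer_weight D i * cos (INR j * t + (INR D - INR j) * node D i))
        + - b j * (fejer_weight D i * sin (INR j * t + (INR D - INR j) * node D i))))).
      * rewrite sumR_swap; apply sumR_ext; intros j Hj.
        rewrite sumR_plus, !sumR_scal.
        destruct (Hmode j Hj) as [-> ->]; ring.
      * intros i _; unfold Rminus at 1.
        rewrite Ropp_mult_distr_l, <- !sumR_scal, <- sumR_plus, <- sumR_scal.
        apply sumR_ext; intros j _.
        rewrite Harg, sin_plus, cos_plus; ring.
Qed.

(** * Translation estimates for vector-valued polynomials *)

Lemma sumR_pair_cauchy (m : nat) (x y p q : nat -> R) :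
  sumR m (fun k => x k * p k + y k * q k)
  <= sqrt (sumR m (fun k => x k ^ 2 + y k ^ 2))
     * sqrt (sumR m (fun k => p k ^ 2 + q k ^ 2)).
Proof.
  assert (Hpos : forall a b : R, 0 <= a ^ 2 + b ^ 2)
    by (intros; apply Rplus_le_le_0_compat; apply pow2_ge_0).
  apply Rle_trans with
    (sumR m (fun k => sqrt (x k ^ 2 + y k ^ 2) * sqrt (p k ^ 2 + q k ^ 2))).
  - apply sumR_le; intros k _.
    pose proof (sqrt_cauchy (x k) (y k) (p k) (q k)) as H.
    now rewrite !Rsqr_pow2 in H.
  - rewrite <- sqrt_mult by (apply sumR_nonneg; intros; apply Hpos).
    apply Rsqr_incr_0_var; [|apply sqrt_pos].
    rewrite Rsqr_sqrt
      by (apply Rmult_le_pos; apply sumR_nonneg; intros; apply Hpos).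
    rewrite Rsqr_pow2.
    eapply Rle_trans; [apply sumR_cauchy_schwarz|].
    right; f_equal; apply sumR_ext; intros; apply pow2_sqrt, Hpos.
Qed.

(** Minkowski's inequality for vectors with one more coordinate [sqrt c], common to both and hence
    absent from their difference. *)
Lemma sqrt_sum_triangle (m : nat) (x y p q : nat -> R) (c : R) :
  0 <= c ->
  sqrt (sumR m (fun k => x k ^ 2 + y k ^ 2) + c)
  <= sqrt (sumR m (fun k => p k ^ 2 + q k ^ 2) + c)
     + sqrt (sumR m (fun k => (x k - p k) ^ 2 + (y k - q k) ^ 2)).
Proof.
  intros Hc.
  pose proof (sumR_pair_cauchy m (fun k => x k - p k) (fun k => y k - q k) p q) as HC.
  assert (E : sumR m (fun k => x k ^ 2 + y k ^ 2)
    = sumR m (fun k => p k ^ 2 + q k ^ 2)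
      + sumR m (fun k => (x k - p k) ^ 2 + (y k - q k) ^ 2)
      + 2 * sumR m (fun k => (x k - p k) * p k + (y k - q k) * q k)).
  { rewrite <- sumR_scal, <- !sumR_plus; apply sumR_ext; intros; ring. }
  rewrite E; clear E.
  set (X := sumR m (fun k => (x k - p k) * p k + (y k - q k) * q k)) in *.
  assert (Hpos : forall a b : R, 0 <= a ^ 2 + b ^ 2)
    by (intros; apply Rplus_le_le_0_compat; apply pow2_ge_0).
  assert (HP : 0 <= sumR m (fun k => p k ^ 2 + q k ^ 2))
    by (apply sumR_nonneg; intros; apply Hpos).
  assert (HD : 0 <= sumR m (fun k => (x k - p k) ^ 2 + (y k - q k) ^ 2))
    by (apply sumR_nonneg; intros; apply Hpos).
  set (P := sumR m (fun k => p k ^ 2 + q k ^ 2)) in *.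
  set (Dl := sumR m (fun k => (x k - p k) ^ 2 + (y k - q k) ^ 2)) in *.
  pose proof (sqrt_pos (P + c)); pose proof (sqrt_pos Dl).
  assert (HPc : sqrt P <= sqrt (P + c)) by (apply sqrt_le_1_alt; lra).
  assert (H1 : sqrt (P + c) * sqrt (P + c) = P + c) by (apply sqrt_sqrt; lra).
  assert (H2 : sqrt Dl * sqrt Dl = Dl) by (now apply sqrt_sqrt).
  rewrite <- (sqrt_Rsqr (sqrt (P + c) + sqrt Dl)) by lra.
  apply sqrt_le_1_alt; unfold Rsqr.
  assert (sqrt Dl * sqrt P <= sqrt Dl * sqrt (P + c))
    by (now apply Rmult_le_compat_l).
  lra.
Qed.

Definition energy (m : nat) (u v : nat -> R -> R) (t : R) : R :=
  sumR m (fun k => u k t ^ 2 + v k t ^ 2).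

Definition increment (m : nat) (u v : nat -> R -> R) (h s : R) : R :=
  sqrt (sumR m (fun k => (u k (s + h) - u k s) ^ 2 + (v k (s + h) - v k s) ^ 2)).

Lemma continuous_comp_R (U : UniformSpace) (f : U -> R) (g : R -> R) (x : U) :
  continuous f x -> (forall y, continuous g y) -> continuous (fun z => g (f z)) x.
Proof. intros Hf Hg; apply continuous_comp; auto. Qed.

Lemma continuous_add (U : UniformSpace) (f g : U -> R) (x : U) :
  continuous f x -> continuous g x -> continuous (fun z => f z + g z) x.
Proof. apply (continuous_plus f g). Qed.

Lemma continuous_pow2 (U : UniformSpace) (f : U -> R) (x : U) :
  continuous f x -> continuous (fun z => f z ^ 2) x.
Proof.
  intros Hf; apply (continuous_comp_R U f (fun y => y ^ 2)); auto.
  intros y; apply (ex_derive_continuous (fun y => y ^ 2)); auto_derive; easy.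
Qed.

Lemma energy_continuous (m : nat) (u v : nat -> R -> R) (t : R) :
  (forall k x, (k < m)%nat -> continuous (u k) x /\ continuous (v k) x) ->
  continuous (energy m u v) t.
Proof.
  intros H; apply (sumR_continuous R_UniformSpace m (fun k t => u k t ^ 2 + v k t ^ 2)).
  intros k Hk; apply continuous_add; apply continuous_pow2; now apply H.
Qed.

Lemma increment_continuous (m : nat) (u v : nat -> R -> R) (h s : R) :
  (forall k x, (k < m)%nat -> continuous (u k) x /\ continuous (v k) x) ->
  continuous (increment m u v h) s.
Proof.
  intros H; apply continuous_sqrt_comp.
  apply (sumR_continuous R_UniformSpace m
    (fun k s => (u k (s + h) - u k s) ^ 2 + (v k (s + h) - v k s) ^ 2)).
  assert (Hs : forall f : R -> R, (forall x, continuous f x) ->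
    continuous (fun s => f (s + h) - f s) s).
  { intros f Hf; apply (continuous_minus (fun s => f (s + h)) f); auto.
    apply (continuous_comp_R R_UniformSpace (fun s => s + h) f); auto.
    apply continuous_add; [apply continuous_id|apply continuous_const]. }
  intros k Hk; apply continuous_add; apply continuous_pow2, Hs; intros; now apply H.
Qed.

Lemma bernstein_pair_continuous (D : nat) (u v : R -> R) (x : R) :
  bernstein_pair D u v -> continuous u x /\ continuous v x.
Proof.
  intros H; destruct (H x) as [Hu Hv].
  split; apply @ex_derive_continuous; eexists; [apply Hu|apply Hv].
Qed.

(* Duality: integrate the derivative of [x |-> <e, G (s + x)>] where [e] is the
   increment itself, and bound it by Cauchy-Schwarz. *)
Lemma increment_le (D m : nat) (u v : nat -> R -> R) (h s : R) :
  (0 < D)%nat -> 0 <= h ->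
  (forall k, (k < m)%nat -> bernstein_pair D (u k) (v k)) ->
  increment m u v h s
  <= RInt (fun x => sumR (2 * D) (fun i =>
       fejer_weight D i * sqrt (energy m u v (s + x - node D i)))) 0 h.
Proof.
  intros HD Hh HB.
  assert (Hcont : forall k x, (k < m)%nat -> continuous (u k) x /\ continuous (v k) x)
    by (intros; now apply (bernstein_pair_continuous D), HB).
  set (g := fun x => sumR (2 * D) (fun i =>
       fejer_weight D i * sqrt (energy m u v (s + x - node D i)))).
  assert (Hg : forall x, continuous g x).
  { intros x; apply (sumR_continuous R_UniformSpace (2 * D) (fun i x =>
      fejer_weight D i * sqrt (energy m u v (s + x - node D i)))).
    intros i _.
    apply (continuous_scal_r (fejer_weight D i)
      (fun x => sqrt (energy m u v (s + x - node D i)))).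
    apply continuous_sqrt_comp.
    apply (continuous_comp_R R_UniformSpace (fun x => s + x - node D i)).
    - apply continuous_add; [apply continuous_add|];
        [apply continuous_const|apply continuous_id|apply continuous_const].
    - intros; now apply energy_continuous. }
  assert (Hg0 : forall x, 0 <= g x).
  { intros; apply sumR_nonneg; intros.
    apply Rmult_le_pos; [now apply fejer_weight_nonneg|apply sqrt_pos]. }
  assert (HW0 : 0 <= RInt g 0 h)
    by (apply RInt_ge_0; auto using ex_RInt_cont).
  set (dl := increment m u v h s).
  assert (Hdl : 0 <= dl) by apply sqrt_pos.
  set (x := fun k => u k (s + h) - u k s).
  set (y := fun k => v k (s + h) - v k s).
  set (e := fun z => sumR m (fun k => x k * u k (s + z) + y k * v k (s + z))).
  (* The test vector [(x, y)] is the increment itself, so pairing it with the increment gives its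
     squared norm. *)
  assert (Hdd : e h - e 0 = dl * dl).
  { unfold dl, increment; rewrite sqrt_sqrt.
    - replace (e h - e 0) with (e h + -1 * e 0) by ring; unfold e.
      rewrite <- sumR_scal, <- sumR_plus; apply sumR_ext; intros k _.
      unfold x, y; rewrite Rplus_0_r; ring.
    - apply sumR_nonneg; intros; apply Rplus_le_le_0_compat; apply pow2_ge_0. }
  assert (He : forall z, exists l, is_derive e z l /\ l <= dl * g z).
  { intros z.
    exists (sumR m (fun k =>
      x k * sumR (2 * D) (fun i => fejer_weight D i *
        (- sin (INR D * node D i) * u k (s + z - node D i)
         - cos (INR D * node D i) * v k (s + z - node D i)))
      + y k * sumR (2 * D) (fun i => fejer_weight D i *
        (cos (INR D * node D i) * u k (s + z - node D i)
         - sin (INR D * node D i) * v k (s + z - node D i))))).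
    split.
    - apply (sumR_is_derive m (fun k z => x k * u k (s + z) + y k * v k (s + z))).
      intros k Hk; destruct (HB k Hk (s + z)) as [Hu Hv].
      assert (Hs : is_derive (fun z => s + z) z 1) by (auto_derive; easy).
      assert (Hc : forall (f : R -> R) (c l : R), is_derive f (s + z) l ->
        is_derive (fun z => c * f (s + z)) z (c * l)).
      { intros f c l Hf; apply (is_derive_scal (fun z => f (s + z))).
        rewrite <- (Rmult_1_l l).
        now apply (is_derive_comp f (fun z => s + z)). }
      apply (is_derive_plus (fun z => x k * u k (s + z)) (fun z => y k * v k (s + z)));
        now apply Hc.
    - unfold g; rewrite <- sumR_scal.
      rewrite (sumR_ext m _ (fun k => sumR (2 * D) (fun i => fejer_weight D i *
        (x k * (- sin (INR D * node D i) * u k (s + z - node D i)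
                - cos (INR D * node D i) * v k (s + z - node D i))
         + y k * (cos (INR D * node D i) * u k (s + z - node D i)
                  - sin (INR D * node D i) * v k (s + z - node D i)))))).
      2:{ intros; rewrite <- !sumR_scal, <- sumR_plus; apply sumR_ext; intros; ring. }
      rewrite sumR_swap; apply sumR_le; intros i _; rewrite sumR_scal.
      replace (dl * (fejer_weight D i * sqrt (energy m u v (s + z - node D i))))
        with (fejer_weight D i * (dl * sqrt (energy m u v (s + z - node D i)))) by ring.
      apply Rmult_le_compat_l; [now apply fejer_weight_nonneg|].
      eapply Rle_trans; [apply sumR_pair_cauchy|].
      right; f_equal; f_equal; apply sumR_ext; intros k _.
      (* Multiplication by [i e^(i D th)] is a rotation, so each translate keeps its modulus. *)
      pose proof (sin2_cos2 (INR D * node D i)) as Hsc; rewrite !Rsqr_pow2 in Hsc.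
      replace (u k (s + z - node D i) ^ 2 + v k (s + z - node D i) ^ 2)
        with ((sin (INR D * node D i) ^ 2 + cos (INR D * node D i) ^ 2)
              * (u k (s + z - node D i) ^ 2 + v k (s + z - node D i) ^ 2))
        by (rewrite Hsc; ring).
      ring. }
  assert (Hmain : dl * dl <= dl * RInt g 0 h).
  (* [F] has nonnegative derivative, so the mean value theorem gives [F 0 <= F h]. *)
  { set (F := fun z => dl * RInt g 0 z - e z).
    assert (HF : forall z, is_derive F z (dl * g z - Derive e z)).
    { intros z.
      apply (is_derive_minus (fun z => dl * RInt g 0 z) e).
      - apply (is_derive_scal (fun z => RInt g 0 z)).
        apply (is_derive_RInt g _ 0); auto.
        apply filter_forall; intros;
          apply (@RInt_correct R_CompleteNormedModule), ex_RInt_cont, Hg.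
      - destruct (He z) as [l [Hl _]]; apply Derive_correct; now exists l. }
    destruct (MVT_gen F 0 h (fun z => dl * g z - Derive e z)) as [c [_ Hc]].
    - intros; apply HF.
    - intros z _; apply continuity_pt_filterlim.
      apply (ex_derive_continuous F); eexists; apply HF.
    - destruct (He c) as [l [Hl Hle]].
      rewrite (is_derive_unique _ _ _ Hl) in Hc.
      assert (H0 : RInt g 0 0 = 0) by apply (@RInt_point R_CompleteNormedModule).
      unfold F in Hc; rewrite H0 in Hc.
      assert (0 <= (dl * g c - l) * (h - 0)) by (apply Rmult_le_pos; lra).
      lra. }
  (* A factor [dl] is cancelled; when it is zero the claim is [HW0]. *)
  destruct (Rle_lt_or_eq_dec 0 dl Hdl) as [Hp|<-]; [|easy].
  now apply (Rmult_le_reg_l dl).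
Qed.

(** After exchanging the integrals, every translate of the periodic norm has the same mean. Only the
    total weight [D] and the length [h] of the interval remain. *)
Lemma Tint_increment_le (D m : nat) (u v : nat -> R -> R) (h : R) :
  (0 < D)%nat -> 0 <= h ->
  (forall k, (k < m)%nat -> bernstein_pair D (u k) (v k)) ->
  (forall k t, (k < m)%nat -> u k (t + 2 * PI) = u k t /\ v k (t + 2 * PI) = v k t) ->
  Tint (increment m u v h) <= h * INR D * Tint (fun t => sqrt (energy m u v t)).
Proof.
  intros HD Hh HB Hper; pose proof two_PI_pos as HP.
  assert (Hcont : forall k x, (k < m)%nat -> continuous (u k) x /\ continuous (v k) x)
    by (intros; now apply (bernstein_pair_continuous D), HB).
  assert (HQ : forall t, continuous (fun t => sqrt (energy m u v t)) t)
    by (intros; apply continuous_sqrt_comp; now apply energy_continuous).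
  set (g := fun s x => sumR (2 * D) (fun i =>
       fejer_weight D i * sqrt (energy m u v (s + x - node D i)))).
  assert (Hg : forall z : R * R, continuous (fun z => g (fst z) (snd z)) z).
  { intros [a b].
    apply (sumR_continuous (prod_UniformSpace R_UniformSpace R_UniformSpace) (2 * D)
      (fun i z => fejer_weight D i * sqrt (energy m u v (fst z + snd z - node D i)))).
    intros i _.
    apply (continuous_scal_r (fejer_weight D i)
      (fun z : R * R => sqrt (energy m u v (fst z + snd z - node D i)))).
    apply (continuous_comp_R _ (fun z : R * R => fst z + snd z - node D i)
      (fun t => sqrt (energy m u v t))); [|easy].
    apply continuous_add; [apply continuous_add|];
      [apply continuous_fst|apply continuous_snd|apply continuous_const]. }
  apply Rle_trans with (Tint (fun s => RInt (g s) 0 h)).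
  - apply Tint_le.
    + intros; now apply increment_continuous.
    + intros; now apply continuous_RInt_param.
    + intros; now apply increment_le.
  - unfold Tint at 1; rewrite RInt_fubini by easy.
    assert (E : forall x, RInt (fun s => g s x) 0 (2 * PI)
      = INR D * RInt (fun t => sqrt (energy m u v t)) 0 (2 * PI)).
    { intros x; unfold g.
      assert (Hci : forall i s, continuous (fun s =>
        sqrt (energy m u v (s + (x - node D i)))) s).
      { intros i s; apply (continuous_comp_R _ (fun s => s + (x - node D i))
          (fun t => sqrt (energy m u v t))); [|easy].
        apply continuous_add; [apply continuous_id|apply continuous_const]. }
      rewrite (RInt_ext _ (fun s => sumR (2 * D) (fun i =>
        fejer_weight D i * sqrt (energy m u v (s + (x - node D i)))))).
      2:{ intros; apply sumR_ext; intros; do 3 f_equal; ring. }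
      rewrite (RInt_sumR (2 * D) (fun i s =>
        fejer_weight D i * sqrt (energy m u v (s + (x - node D i))))).
      2:{ intros i s _; apply (continuous_scal_r (fejer_weight D i)
            (fun s => sqrt (energy m u v (s + (x - node D i)))) s), Hci. }
      rewrite <- (fejer_weight_sum D) by easy.
      rewrite (Rmult_comm (sumR _ _)), <- sumR_scal; apply sumR_ext; intros i _.
      rewrite (Rmult_comm _ (fejer_weight D i)).
      rewrite <- (RInt_periodic_shift (fun t => sqrt (energy m u v t))
        (2 * PI) (x - node D i)); auto.
      + apply (RInt_scal (fun s => sqrt (energy m u v (s + (x - node D i))))).
        apply ex_RInt_cont, Hci.
      + intros t; f_equal; apply sumR_ext; intros k Hk.
        now destruct (Hper k t Hk) as [-> ->]. }
    rewrite (RInt_ext _ (fun _ =>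
      INR D * RInt (fun t => sqrt (energy m u v t)) 0 (2 * PI))) by (intros; apply E).
    rewrite RInt_const; unfold scal; simpl; unfold mult; simpl.
    unfold Tint; right; field; lra.
Qed.

(** * Decoupling one variable *)

Lemma periodic_IZR (f : R -> R) (h x : R) (z : Z) :
  (forall y, f (y + h) = f y) -> f (x + IZR z * h) = f x.
Proof.
  intros H.
  assert (Hn : forall n y, f (y + INR n * h) = f y).
  { induction n as [|n IH]; intros y; [f_equal; simpl; ring|].
    rewrite S_INR, <- (IH y), <- (H (y + INR n * h)); f_equal; ring. }
  destruct (Z.le_gt_cases 0 z) as [Hz|Hz].
  - now rewrite <- (Z2Nat.id z), <- INR_IZR_INZ.
  - rewrite <- (Hn (Z.to_nat (- z)) (x + IZR z * h)), INR_IZR_INZ, Z2Nat.id by lia.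
    rewrite opp_IZR; f_equal; ring.
Qed.

(** [P k] stands for the squared modulus of component [k]; [c] collects the components of larger
    index whose own variables are held fixed. *)
Definition diag_avg (P : nat -> R -> R) (m : nat) (c : R) : R :=
  Tint (fun t => sqrt (sumR m (fun k => P k t) + c)).

(* [J u], the average of [sqrt (Q (s + u) + p s + c)] over [s], is [2 PI / N]-periodic;
   [J 0] and the mean of [J] are the coupled and the decoupled averages. *)
Lemma decouple_step (D N m : nat) (u v : nat -> R -> R) (p : R -> R) (c : R) :
  (0 < D)%nat -> (0 < N)%nat ->
  (forall k, (k < m)%nat -> bernstein_pair D (u k) (v k)) ->
  (forall k t, (k < m)%nat -> u k (t + 2 * PI) = u k t /\ v k (t + 2 * PI) = v k t) ->
  (forall t, continuous p t) -> (forall t, 0 <= p t) ->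
  (forall t, p (t + 2 * PI / INR N) = p t) -> 0 <= c ->
  Rabs (Tint (fun t => sqrt (energy m u v t + (p t + c)))
        - Tint (fun s => Tint (fun t => sqrt (energy m u v t + (p s + c)))))
  <= 2 * PI * (INR D / INR N) * Tint (fun t => sqrt (energy m u v t)).
Proof.
  intros HD HN HB Hper Hpc Hp0 Hpp Hc.
  apply lt_0_INR in HN; pose proof two_PI_pos as HPI.
  set (h := 2 * PI / INR N) in *.
  assert (Hh : 0 < h) by now apply Rdiv_lt_0_compat.
  assert (Hcont : forall k x, (k < m)%nat -> continuous (u k) x /\ continuous (v k) x)
    by (intros; now apply (bernstein_pair_continuous D), HB).
  assert (HQc : forall t, continuous (energy m u v) t)
    by (intros; now apply energy_continuous).
  assert (HQp : forall t, energy m u v (t + 2 * PI) = energy m u v t).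
  { intros t; apply sumR_ext; intros k Hk; now destruct (Hper k t Hk) as [-> ->]. }
  assert (Hpp' : forall t, p (t + 2 * PI) = p t).
  { intros t; rewrite <- (periodic_IZR p h t (Z.of_nat N)), <- INR_IZR_INZ by easy.
    f_equal; unfold h; field; lra. }
  set (f := fun t s => sqrt (energy m u v t + (p s + c))).
  assert (Hf : forall (U : UniformSpace) (g1 g2 : U -> R) z,
    continuous g1 z -> continuous g2 z -> continuous (fun z => f (g1 z) (g2 z)) z).
  { intros U g1 g2 z H1 H2.
    apply (continuous_comp_R U (fun z => energy m u v (g1 z) + (p (g2 z) + c)) sqrt).
    - apply continuous_add; [now apply continuous_comp_R|].
      apply continuous_add; [now apply continuous_comp_R|apply continuous_const].
    - apply continuous_sqrt. }
  set (J := fun u => Tint (fun s => f (s + u) s)).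
  assert (Hjoint : forall z : R * R,
    continuous (fun z : R * R => f (snd z + fst z) (snd z)) z).
  { intros [x y]; apply (Hf _ (fun z : R * R => snd z + fst z) (fun z : R * R => snd z)).
    - apply continuous_add; [apply continuous_snd|apply continuous_fst].
    - apply continuous_snd. }
  assert (HJc : forall x, continuous J x)
    by (intros; apply (Tint_continuous (fun u s => f (s + u) s)), Hjoint).
  (* With [s] fixed, [u] runs over the whole circle, and translation invariance replaces [s + u] by
     a free variable [t]. *)
  assert (HJmean : Tint J = Tint (fun s => Tint (fun t => f t s))).
  { unfold J; rewrite (Tint_swap (fun u s => f (s + u) s)) by apply Hjoint.
    apply Tint_ext; intros s.
    rewrite <- (Tint_shift (fun t => f t s) s).
    - apply Tint_ext; intros; f_equal; ring.
    - intros t; apply (Hf _ (fun t => t) (fun _ => s));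
        [apply continuous_id|apply continuous_const].
    - intros t; unfold f; now rewrite HQp. }
  (* Since [p] has period [h], moving only the argument of the energy by [h] amounts to moving [s]
     by [h] in both places, which leaves the average unchanged. *)
  assert (HJp : forall x, J (x + h) = J x).
  { intros x; unfold J.
    rewrite <- (Tint_shift (fun s => f (s + x) s) h).
    - apply Tint_ext; intros s; unfold f; rewrite Hpp; do 3 f_equal; ring.
    - intros s; apply (Hf _ (fun s => s + x) (fun s => s)); [|apply continuous_id].
      apply continuous_add; [apply continuous_id|apply continuous_const].
    - intros s; unfold f; rewrite Hpp', <- (HQp (s + x)); do 3 f_equal; ring. }
  assert (HJ0 : Tint (fun t => f t t) = J 0)
    by (apply Tint_ext; intros; now rewrite Rplus_0_r).
  set (T := Tint (fun t => sqrt (energy m u v t))).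
  assert (HT : 0 <= T).
  { apply Tint_nonneg; intros; [now apply continuous_sqrt_comp|apply sqrt_pos]. }
  assert (Hsmall : forall x, 0 <= x <= h -> Rabs (J x - J 0) <= h * INR D * T).
  { intros x Hx.
    apply Rle_trans with (Tint (increment m u v x)).
    - unfold J; apply Tint_abs_minus_le.
      + intros s; apply (Hf _ (fun s => s + x) (fun s => s)); [|apply continuous_id].
        apply continuous_add; [apply continuous_id|apply continuous_const].
      + intros s; apply (Hf _ (fun s => s + 0) (fun s => s)); [|apply continuous_id].
        apply continuous_add; [apply continuous_id|apply continuous_const].
      + intros; now apply increment_continuous.
      + intros s; rewrite Rplus_0_r; unfold f, energy, increment.
        assert (Hpc0 : 0 <= p s + c) by (specialize (Hp0 s); lra).
        pose proof (sqrt_sum_triangle m (fun k => u k (s + x)) (fun k => v k (s + x))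
          (fun k => u k s) (fun k => v k s) _ Hpc0) as H1.
        pose proof (sqrt_sum_triangle m (fun k => u k s) (fun k => v k s)
          (fun k => u k (s + x)) (fun k => v k (s + x)) _ Hpc0) as H2.
        cbv beta in H1, H2.
        rewrite (sumR_ext m (fun k => (u k s - u k (s + x)) ^ 2 + (v k s - v k (s + x)) ^ 2)
          (fun k => (u k (s + x) - u k s) ^ 2 + (v k (s + x) - v k s) ^ 2)) in H2
          by (intros; ring).
        apply Rabs_le; lra.
    - eapply Rle_trans; [apply (Tint_increment_le D); auto; lra|].
      apply Rmult_le_compat_r; [easy|].
      apply Rmult_le_compat_r; [apply pos_INR|lra]. }
  assert (Hall : forall x, Rabs (J x - J 0) <= h * INR D * T).
  { intros x.
    (* Periodicity reduces any translation to one by less than [h]; this is where the small period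
       pays off. *)
    rewrite <- (periodic_IZR J h x (- Int_part (x / h))) by easy.
    apply Hsmall.
    destruct (base_Int_part (x / h)) as [H1 H2]; rewrite opp_IZR.
    assert (E : x = x / h * h) by (field; lra).
    set (z := IZR (Int_part (x / h))) in *; set (w := x / h) in *.
    rewrite E; split; nra. }
  change (Rabs (Tint (fun t => f t t) - Tint (fun s => Tint (fun t => f t s)))
    <= 2 * PI * (INR D / INR N) * T).
  rewrite <- HJmean, HJ0, Rabs_minus_sym, <- (Tint_const (J 0)).
  replace (2 * PI * (INR D / INR N) * T) with (h * INR D * T) by (unfold h; field; lra).
  rewrite <- (Tint_const (h * INR D * T)).
  apply Tint_abs_minus_le; auto; intros; apply continuous_const.
Qed.

(** * Independent averages *)

(** The iterated integral without points of the torus: outer variables affect the inner integrals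
    only through the sum accumulated in [c]. *)
Fixpoint ind_avg (P : nat -> R -> R) (m : nat) (c : R) : R :=
  match m with
  | O => sqrt c
  | S m' => Tint (fun s => ind_avg P m' (P m' s + c))
  end.

Lemma Tint_iter_ext (m : nat) (F G : (nat -> R) -> R) :
  (forall t, F t = G t) -> Tint_iter m F = Tint_iter m G.
Proof.
  revert F G; induction m as [|m IH]; intros F G H; simpl; [apply H|].
  apply Tint_ext; intros s; apply IH; intros; apply H.
Qed.

Lemma Tint_iter_ind_avg (P : nat -> R -> R) (m : nat) (c : R) :
  Tint_iter m (fun t => sqrt (sumR m (fun k => P k (t k)) + c)) = ind_avg P m c.
Proof.
  revert c; induction m as [|m IH]; intros c; simpl; [f_equal; ring|].
  apply Tint_ext; intros s; rewrite <- IH.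
  apply Tint_iter_ext; intros t; unfold upd at 2; rewrite Nat.eqb_refl, Rplus_assoc.
  do 2 f_equal; apply sumR_ext; intros k Hk.
  unfold upd; now rewrite (proj2 (Nat.eqb_neq k m)) by lia.
Qed.

Lemma sqrt_plus_le (x y : R) : 0 <= x -> 0 <= y -> sqrt (x + y) <= sqrt x + sqrt y.
Proof.
  intros Hx Hy; pose proof (sqrt_pos x); pose proof (sqrt_pos y).
  rewrite <- (sqrt_Rsqr (sqrt x + sqrt y)) by lra.
  apply sqrt_le_1_alt; unfold Rsqr.
  pose proof (sqrt_sqrt x Hx); pose proof (sqrt_sqrt y Hy).
  assert (0 <= sqrt x * sqrt y) by now apply Rmult_le_pos.
  lra.
Qed.

Lemma sqrt_sumR_le (q : nat) (x : nat -> R) :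
  (forall r, (r < q)%nat -> 0 <= x r) -> sqrt (sumR q x) <= sumR q (fun r => sqrt (x r)).
Proof.
  induction q as [|q IH]; intros H; simpl; [rewrite sqrt_0; lra|].
  assert (forall r, (r < q)%nat -> 0 <= x r) by (intros; apply H; lia).
  eapply Rle_trans; [apply sqrt_plus_le; [now apply sumR_nonneg|apply H; lia]|].
  apply Rplus_le_compat_r; auto.
Qed.

Lemma sqrt_holder (x y : R) : Rabs (sqrt x - sqrt y) <= sqrt (Rabs (x - y)).
Proof.
  assert (H : forall a b, a <= b -> sqrt b - sqrt a <= sqrt (b - a)).
  { intros a b Hab; destruct (Rle_dec 0 a) as [Ha|Ha].
    - pose proof (sqrt_plus_le a (b - a) Ha ltac:(lra)) as Hs.
      replace (a + (b - a)) with b in Hs by ring; lra.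
    - rewrite (sqrt_neg_0 a) by lra.
      assert (sqrt b <= sqrt (b - a)) by (apply sqrt_le_1_alt; lra); lra. }
  destruct (Rle_dec x y) as [Hxy|Hxy].
  - rewrite Rabs_minus_sym, (Rabs_minus_sym x).
    rewrite !Rabs_pos_eq; auto; try lra.
    assert (sqrt x <= sqrt y) by now apply sqrt_le_1_alt. lra.
  - rewrite !Rabs_pos_eq; [apply H; lra|lra|].
    assert (sqrt y <= sqrt x) by (apply sqrt_le_1_alt; lra). lra.
Qed.

Lemma holder_continuous (f : R -> R) (x : R) :
  (forall y z, Rabs (f y - f z) <= sqrt (Rabs (y - z))) -> continuous f x.
Proof.
  intros H; apply filterlim_locally; intros eps.
  exists (mkposreal (eps * eps) (Rmult_lt_0_compat _ _ (cond_pos eps) (cond_pos eps))).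
  intros y Hy; change (Rabs (y - x) < eps * eps) in Hy.
  change (Rabs (f y - f x) < eps).
  apply Rle_lt_trans with (sqrt (Rabs (y - x))); [apply H|].
  rewrite <- (sqrt_square eps) by (left; apply cond_pos).
  apply sqrt_lt_1_alt; split; [apply Rabs_pos|easy].
Qed.

(** A modulus of continuity in [c] that does not depend on [m] passes through each average
    unchanged. It yields continuity of all inner integrands, even where [sqrt] fails to be
    Lipschitz. *)
Lemma ind_avg_holder (P : nat -> R -> R) (m : nat) (c c' : R) :
  (forall k t, continuous (P k) t) ->
  Rabs (ind_avg P m c - ind_avg P m c') <= sqrt (Rabs (c - c')).
Proof.
  intros HP; revert c c'; induction m as [|m IH]; intros c c'; simpl.
  - apply sqrt_holder.
  - assert (Hc : forall c s, continuous (fun s => ind_avg P m (P m s + c)) s).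
    { intros b s; apply (continuous_comp_R _ (fun s => P m s + b) (ind_avg P m)).
      - apply continuous_add; [apply HP|apply continuous_const].
      - intros; now apply holder_continuous. }
    rewrite <- (Tint_const (sqrt (Rabs (c - c')))).
    apply Tint_abs_minus_le; auto.
    + intros; apply continuous_const.
    + intros s; replace (c - c') with (P m s + c - (P m s + c')) by ring; apply IH.
Qed.

Lemma ind_avg_continuous (P : nat -> R -> R) (m : nat) (c s : R) :
  (forall k t, continuous (P k) t) ->
  continuous (fun s => ind_avg P m (P m s + c)) s.
Proof.
  intros HP; apply (continuous_comp_R _ (fun s => P m s + c) (ind_avg P m)).
  - apply continuous_add; [apply HP|apply continuous_const].
  - intros; apply holder_continuous; intros; now apply ind_avg_holder.
Qed.

Lemma ind_avg_mono (P P' : nat -> R -> R) (m : nat) (c c' : R) :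
  (forall k t, continuous (P k) t) -> (forall k t, continuous (P' k) t) ->
  (forall k t, P k t <= P' k t) -> c <= c' ->
  ind_avg P m c <= ind_avg P' m c'.
Proof.
  intros HP HP' H; revert c c'; induction m as [|m IH]; intros c c' Hc; simpl.
  - now apply sqrt_le_1_alt.
  - apply Tint_le; try (intros; now apply ind_avg_continuous).
    intros s; apply IH; specialize (H m s); lra.
Qed.

(** Comes from [sqrt (x + y) <= sqrt x + sqrt y]. The constant is split as well, because each
    integration adds a term to every summand's own constant. *)
Lemma ind_avg_subadditive (q : nat) (P : nat -> nat -> R -> R) (m : nat) (c : nat -> R) :
  (forall r k t, continuous (P r k) t) -> (forall r k t, 0 <= P r k t) ->
  (forall r, 0 <= c r) ->
  ind_avg (fun k t => sumR q (fun r => P r k t)) m (sumR q c)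
  <= sumR q (fun r => ind_avg (P r) m (c r)).
Proof.
  intros HP HP0; revert c; induction m as [|m IH]; intros c Hc; simpl.
  - now apply sqrt_sumR_le.
  - rewrite <- (Tint_sumR q (fun r s => ind_avg (P r) m (P r m s + c r)))
      by (intros; now apply ind_avg_continuous).
    apply Tint_le.
    + intros s; apply (ind_avg_continuous (fun k t => sumR q (fun r => P r k t))).
      intros k t; now apply (sumR_continuous R_UniformSpace q (fun r t => P r k t)).
    + intros s; apply (sumR_continuous R_UniformSpace q
        (fun r s => ind_avg (P r) m (P r m s + c r))).
      intros; now apply ind_avg_continuous.
    + intros s; rewrite <- sumR_plus; apply IH.
      intros r; now apply Rplus_le_le_0_compat.
Qed.

Lemma diag_integrand_continuous (P : nat -> R -> R) (m : nat) (c t : R) :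
  (forall k t, continuous (P k) t) ->
  continuous (fun t => sqrt (sumR m (fun k => P k t) + c)) t.
Proof.
  intros HP; apply continuous_sqrt_comp, continuous_add; [|apply continuous_const].
  apply (sumR_continuous R_UniformSpace m P); auto.
Qed.

Lemma diag_avg_mono (P P' : nat -> R -> R) (m m' : nat) (c c' : R) :
  (forall k t, continuous (P k) t) -> (forall k t, continuous (P' k) t) ->
  (forall t, sumR m (fun k => P k t) + c <= sumR m' (fun k => P' k t) + c') ->
  diag_avg P m c <= diag_avg P' m' c'.
Proof.
  intros HP HP' H; apply Tint_le; try (intros; now apply diag_integrand_continuous).
  intros t; apply sqrt_le_1_alt, H.
Qed.

Lemma diag_avg_subadditive (q : nat) (P : nat -> nat -> R -> R) (m : nat) :
  (forall r k t, continuous (P r k) t) -> (forall r k t, 0 <= P r k t) ->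
  diag_avg (fun k t => sumR q (fun r => P r k t)) m 0
  <= sumR q (fun r => diag_avg (P r) m 0).
Proof.
  intros HP HP0; unfold diag_avg.
  rewrite <- (Tint_sumR q (fun r t => sqrt (sumR m (fun k => P r k t) + 0)))
    by (intros; now apply diag_integrand_continuous).
  apply Tint_le.
  - intros; apply (diag_integrand_continuous (fun k t => sumR q (fun r => P r k t))).
    intros k t; now apply (sumR_continuous R_UniformSpace q (fun r t => P r k t)).
  - intros t; apply (sumR_continuous R_UniformSpace q
      (fun r t => sqrt (sumR m (fun k => P r k t) + 0))).
    intros; now apply diag_integrand_continuous.
  - intros t; rewrite Rplus_0_r, sumR_swap.
    eapply Rle_trans; [apply sqrt_sumR_le; intros; now apply sumR_nonneg|].
    right; apply sumR_ext; intros; now rewrite Rplus_0_r.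
Qed.

Lemma diag_avg_continuous (P : nat -> R -> R) (m : nat) (c s : R) :
  (forall k t, continuous (P k) t) ->
  continuous (fun s => diag_avg P m (P m s + c)) s.
Proof.
  intros HP.
  apply (Tint_continuous (fun s t => sqrt (sumR m (fun k => P k t) + (P m s + c)))).
  intros [x y].
  apply (continuous_comp_R _ (fun z : R * R =>
    sumR m (fun k => P k (snd z)) + (P m (fst z) + c)) sqrt); [|apply continuous_sqrt].
  apply continuous_add; [|apply continuous_add; [|apply continuous_const]].
  - apply (sumR_continuous _ m (fun k (z : R * R) => P k (snd z))).
    intros; apply continuous_comp_R; [apply continuous_snd|auto].
  - apply continuous_comp_R; [apply continuous_fst|auto].
Qed.

(** * Iterating the decoupling *)

Lemma exp_mono (x y : R) : x <= y -> exp x <= exp y.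
Proof. intros [H| ->]; [left; now apply exp_increasing|lra]. Qed.

Lemma one_plus_le_exp (e x : R) : 0 <= x -> x + e * x <= exp e * x.
Proof.
  intros Hx; replace (x + e * x) with ((1 + e) * x) by ring.
  apply Rmult_le_compat_r; [easy|apply exp_ineq1_le].
Qed.

(** Let [X] be the coupled average and [Y] the one with variable [m] independent. Both are at least
    [diag_avg P m 0], so the additive error becomes a factor [1 + eps m <= exp (eps m)] in each
    direction. The induction hypothesis is used under the integral with the constant [P m s + c]. *)
Lemma ind_diag_compare (P : nat -> R -> R) (eps : nat -> R) (n : nat) :
  (forall k t, continuous (P k) t) -> (forall k t, 0 <= P k t) ->
  (forall k, 0 <= eps k) ->
  (forall m c, (m < n)%nat -> 0 <= c ->
    Rabs (diag_avg P (S m) c - Tint (fun s => diag_avg P m (P m s + c)))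
    <= eps m * diag_avg P m 0) ->
  forall m c, (m <= n)%nat -> 0 <= c ->
    ind_avg P m c <= exp (sumR m eps) * diag_avg P m c /\
    diag_avg P m c <= exp (sumR m eps) * ind_avg P m c.
Proof.
  intros HP HP0 Heps Hstep.
  induction m as [|m IH]; intros c Hm Hc.
  - simpl; rewrite exp_0, !Rmult_1_l; unfold diag_avg; simpl.
    rewrite Tint_const, Rplus_0_l; lra.
  - simpl ind_avg; simpl sumR; rewrite exp_plus.
    set (E := exp (sumR m eps)).
    assert (HE : 0 < E) by apply exp_pos.
    set (Y := Tint (fun s => diag_avg P m (P m s + c))).
    set (I := Tint (fun s => ind_avg P m (P m s + c))).
    assert (HIc : forall s, continuous (fun s => ind_avg P m (P m s + c)) s)
      by (intros; now apply ind_avg_continuous).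
    assert (HYc : forall s, continuous (fun s => diag_avg P m (P m s + c)) s)
      by (intros; now apply diag_avg_continuous).
    assert (HIH : forall s, ind_avg P m (P m s + c) <= E * diag_avg P m (P m s + c) /\
                            diag_avg P m (P m s + c) <= E * ind_avg P m (P m s + c)).
    { intros s; apply IH; [lia|]; apply Rplus_le_le_0_compat; auto. }
    assert (H1 : I <= E * Y).
    { unfold Y; rewrite <- Tint_scal by easy; apply Tint_le; auto.
      - intros; now apply (continuous_scal_r E (fun s => diag_avg P m (P m s + c))).
      - intros; apply HIH. }
    assert (H2 : Y <= E * I).
    { unfold I; rewrite <- Tint_scal by easy; apply Tint_le; auto.
      - intros; now apply (continuous_scal_r E (fun s => ind_avg P m (P m s + c))).
      - intros; apply HIH. }
    assert (H0 : 0 <= diag_avg P m 0).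
    { apply Tint_nonneg; intros; [now apply diag_integrand_continuous|apply sqrt_pos]. }
    assert (HX : diag_avg P m 0 <= diag_avg P (S m) c).
    { apply diag_avg_mono; auto; intros t; simpl; specialize (HP0 m t); lra. }
    assert (HY : diag_avg P m 0 <= Y).
    { unfold Y; rewrite <- (Tint_const (diag_avg P m 0)); apply Tint_le; auto.
      - intros; apply continuous_const.
      - intros s; apply diag_avg_mono; auto; intros t; specialize (HP0 m s); lra. }
    assert (Hs : Rabs (diag_avg P (S m) c - Y) <= eps m * diag_avg P m 0)
      by (apply Hstep; [lia|easy]).
    apply Rabs_le_between in Hs.
    set (X := diag_avg P (S m) c) in *.
    pose proof (Rmult_le_compat_l _ _ _ (Heps m) HX) as HeX.
    pose proof (Rmult_le_compat_l _ _ _ (Heps m) HY) as HeY.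
    pose proof (one_plus_le_exp (eps m) X ltac:(lra)).
    pose proof (one_plus_le_exp (eps m) Y ltac:(lra)).
    split.
    + apply Rle_trans with (E * Y); [easy|].
      rewrite Rmult_assoc; apply Rmult_le_compat_l; lra.
    + apply Rle_trans with (exp (eps m) * Y); [lra|].
      rewrite (Rmult_comm E), Rmult_assoc.
      apply Rmult_le_compat_l; [left; apply exp_pos|easy].
Qed.

(** * Series bounds and residue classes of indices *)

Lemma sumR_le_series (f : nat -> R) (l : R) (n : nat) :
  (forall k, 0 <= f k) -> is_series f l -> sumR n f <= l.
Proof.
  intros Hf Hl.
  assert (E : forall k, sum_n f k = sumR (S k) f).
  { induction k as [|k IH]; [rewrite sum_O; simpl; ring|].
    rewrite sum_Sn, IH; reflexivity. }
  (* [sum_n f n] includes the index [n], hence one term more than [sumR n f]. *)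
  apply Rle_trans with (sum_n f n).
  - rewrite E; simpl; specialize (Hf n); lra.
  - apply (is_lim_seq_incr_compare (sum_n f) l).
    + exact Hl.
    + intros k; rewrite !E; simpl; specialize (Hf (S k)); lra.
Qed.

Lemma sumR_split (a n : nat) (f : nat -> R) :
  sumR (a + n) f = sumR a f + sumR n (fun k => f (a + k)%nat).
Proof.
  induction n as [|n IH]; [rewrite Nat.add_0_r; simpl; ring|].
  rewrite Nat.add_succ_r; simpl; rewrite IH; ring.
Qed.

Lemma lacunary_mono (d : nat -> nat) (k l : nat) :
  lacunary d -> (k <= l)%nat -> (d k <= d l)%nat.
Proof.
  intros [_ [q [Hq H]]] Hkl; induction Hkl as [|l _ IH]; [easy|].
  apply Nat.le_trans with (1 := IH), INR_le.
  specialize (H l); pose proof (pos_INR (d l)); nra.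
Qed.

Lemma trig_2PI_periodic (a b : nat -> R) (d : nat) : trig_periodic a b d (2 * PI).
Proof.
  intros t.
  assert (E : forall j, INR j * (t + 2 * PI) = INR j * t + 2 * INR j * PI)
    by (intros; ring).
  split; apply sumR_ext; intros j _; now rewrite E, cos_period, sin_period.
Qed.

(** Other classes are set to zero instead of renumbering, so [d], [N] and the order of integration
    keep their indices. *)
Definition on_class (q r : nat) (f : nat -> R -> R) (k : nat) (t : R) : R :=
  if (k mod q =? r)%nat then f k t else 0.

Lemma sumR_on_class (q : nat) (f : nat -> R -> R) (k : nat) (t : R) :
  (0 < q)%nat -> sumR q (fun r => on_class q r f k t) = f k t.
Proof.
  intros Hq; unfold on_class.
  assert (H : forall n, sumR n (fun r => if (k mod q =? r)%nat then f k t else 0)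
    = if (k mod q <? n)%nat then f k t else 0).
  { induction n as [|n IH]; [easy|]; simpl sumR; rewrite IH.
    destruct (Nat.ltb_spec (k mod q) n), (Nat.ltb_spec (k mod q) (S n)),
      (Nat.eqb_spec (k mod q) n); try ring; lia. }
  rewrite H, (proj2 (Nat.ltb_lt _ _)); [easy|apply Nat.mod_upper_bound; lia].
Qed.

Lemma same_class_gap (q k m : nat) :
  (0 < q)%nat -> (k < m)%nat -> k mod q = m mod q -> (k + q <= m)%nat.
Proof.
  intros Hq Hkm E.
  pose proof (Nat.div_mod k q ltac:(lia)); pose proof (Nat.div_mod m q ltac:(lia)).
  assert (k / q < m / q)%nat by nia.
  nia.
Qed.

Definition trig_sq (a b : nat -> nat -> R) (d : nat -> nat) (k : nat) (t : R) : R :=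
  trig_re (a k) (b k) (d k) t ^ 2 + trig_im (a k) (b k) (d k) t ^ 2.

Lemma class_sq_nonneg (q r : nat) (a b : nat -> nat -> R) (d : nat -> nat) (k : nat)
    (t : R) :
  0 <= on_class q r (trig_sq a b d) k t.
Proof.
  unfold on_class; destruct (_ =? _)%nat; [|lra].
  apply Rplus_le_le_0_compat; apply pow2_ge_0.
Qed.

Lemma trig_sq_continuous (a b : nat -> nat -> R) (d : nat -> nat) (k : nat) (t : R) :
  continuous (trig_sq a b d k) t.
Proof.
  (* The successor makes the common degree positive even when [d k = 0]. *)
  destruct (bernstein_pair_continuous (S (d k)) (trig_re (a k) (b k) (d k))
    (trig_im (a k) (b k) (d k)) t); [apply trig_bernstein_pair; lia|].
  apply continuous_add; now apply continuous_pow2.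
Qed.

Lemma class_sq_continuous (q r : nat) (a b : nat -> nat -> R) (d : nat -> nat) (k : nat)
    (t : R) :
  continuous (on_class q r (trig_sq a b d) k) t.
Proof.
  unfold on_class; destruct (_ =? _)%nat; [|apply continuous_const].
  apply trig_sq_continuous.
Qed.

(** If [m] is in the class, earlier members have index below [m - a0], so their degrees are at most
    [d (m - a0)] and [decouple_step] applies. If not, [P m] is zero and the two averages
    coincide. *)
Lemma class_decouple_step (d N : nat -> nat) (a0 n r m : nat) (a b : nat -> nat -> R)
    (c : R) :
  lacunary d -> (forall k, (0 < N k)%nat) ->
  (forall k, (k < n)%nat -> trig_periodic (a k) (b k) (d k) (2 * PI / INR (N k))) ->
  (m < n)%nat -> 0 <= c ->
  let P := on_class (S a0) r (trig_sq a b d) in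
  Rabs (diag_avg P (S m) c - Tint (fun s => diag_avg P m (P m s + c)))
  <= 2 * PI * (INR (d (m - a0)%nat) / INR (N m)) * diag_avg P m 0.
Proof.
  intros Hd HN Hper Hm Hc P.
  destruct (Nat.eqb_spec (m mod S a0) r) as [Hr|Hr].
  - set (u := on_class (S a0) r (fun k => trig_re (a k) (b k) (d k))).
    set (v := on_class (S a0) r (fun k => trig_im (a k) (b k) (d k))).
    assert (EP : forall k t, P k t = u k t ^ 2 + v k t ^ 2).
    { intros; unfold P, u, v, on_class, trig_sq; destruct (_ =? _)%nat; ring. }
    assert (EQ : forall t, sumR m (fun k => P k t) = energy m u v t)
      by (intros; apply sumR_ext; intros; apply EP).
    (* Truncated subtraction gives [d 0] for [m <= a0]; no earlier index then shares the class of
       [m]. *)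
    assert (HD : (0 < d (m - a0))%nat) by apply Hd.
    unfold diag_avg.
    rewrite (Tint_ext _ (fun t => sqrt (energy m u v t + (P m t + c))))
      by (intros; simpl; rewrite EQ; f_equal; ring).
    rewrite (Tint_ext (fun s => Tint _)
      (fun s => Tint (fun t => sqrt (energy m u v t + (P m s + c)))))
      by (intros; apply Tint_ext; intros; now rewrite EQ).
    rewrite (Tint_ext (fun t => sqrt (sumR m _ + 0)) (fun t => sqrt (energy m u v t)))
      by (intros; now rewrite EQ, Rplus_0_r).
    apply decouple_step; auto.
    + intros k Hk; unfold u, v, on_class.
      destruct (Nat.eqb_spec (k mod S a0) r) as [Hkr|Hkr].
      * apply trig_bernstein_pair; [easy|].
        apply lacunary_mono; [easy|].
        pose proof (same_class_gap (S a0) k m ltac:(lia) Hk ltac:(congruence)); lia.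
      * apply bernstein_pair_zero.
    + intros k t _; unfold u, v, on_class; destruct (_ =? _)%nat; [|easy].
      apply trig_2PI_periodic.
    + intros; apply class_sq_continuous.
    + intros; apply class_sq_nonneg.
    + intros t; unfold P, on_class, trig_sq; destruct (_ =? _)%nat; [|easy].
      now destruct (Hper m Hm t) as [-> ->].
  - assert (EP : forall t, P m t = 0).
    { intros; unfold P, on_class; now rewrite (proj2 (Nat.eqb_neq _ _) Hr). }
    rewrite (Tint_ext (fun s => diag_avg P m (P m s + c)) (fun _ => diag_avg P m c))
      by (intros; now rewrite EP, Rplus_0_l).
    rewrite Tint_const.
    replace (diag_avg P (S m) c) with (diag_avg P m c)
      by (apply Tint_ext; intros; simpl; now rewrite EP, Rplus_0_r).
    rewrite Rminus_diag, Rabs_R0.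
    assert (0 < INR (N m)) by apply lt_0_INR, HN.
    pose proof two_PI_pos.
    apply Rmult_le_pos; [apply Rmult_le_pos; [lra|apply Rdiv_le_0_compat;
      [apply pos_INR|easy]]|].
    apply Tint_nonneg; intros; [|apply sqrt_pos].
    apply diag_integrand_continuous; intros; apply class_sq_continuous.
Qed.

Theorem theorem2p9 (d N : nat -> nat) :
  lacunary d ->
  (forall k, (0 < N k)%nat) ->
  (exists a0 : nat, ex_series (fun k => INR (d k) / INR (N (k + a0)%nat))) ->
  exists C : R, 1 <= C /\
    forall (n : nat) (a b : nat -> nat -> R),
      (forall k, (k < n)%nat -> trig_periodic (a k) (b k) (d k) (2 * PI / INR (N k))) ->
      / C * norm_ind n a b d <= norm_L1l2 n a b d /\
      norm_L1l2 n a b d <= C * norm_ind n a b d.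
Proof.
  intros Hd HN [a0 [l Hl]].
  pose proof two_PI_pos as HPI.
  assert (HN' : forall k, 0 < INR (N k)) by (intros; apply lt_0_INR, HN).
  assert (Hfrac : forall k j, 0 <= INR (d k) / INR (N j))
    by (intros; apply Rdiv_le_0_compat; [apply pos_INR|apply HN']).
  set (eps := fun m => 2 * PI * (INR (d (m - a0)%nat) / INR (N m))).
  assert (Heps : forall m, 0 <= eps m) by (intros; apply Rmult_le_pos; [lra|apply Hfrac]).
  (* The first [a0] terms, where [m - a0] is truncated, are kept as they are; from index [a0] on,
     [eps] is [2 PI] times the given series. *)
  set (K := sumR a0 eps + 2 * PI * l).
  assert (HK : forall n, sumR n eps <= K).
  { intros n; apply Rle_trans with (sumR (a0 + n) eps).
    - rewrite Nat.add_comm, sumR_split.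
      pose proof (sumR_nonneg a0 (fun k => eps (n + k)%nat) ltac:(intros; apply Heps)).
      lra.
    - rewrite sumR_split; apply Rplus_le_compat_l.
      rewrite (sumR_ext n _ (fun k => 2 * PI * (INR (d k) / INR (N (k + a0)%nat)))).
      + rewrite sumR_scal; apply Rmult_le_compat_l; [lra|].
        apply sumR_le_series; auto.
      + intros k _; unfold eps; rewrite (Nat.add_comm a0).
        now replace (k + a0 - a0)%nat with k by lia. }
  assert (HK0 : 0 <= K) by (apply (HK 0%nat)).
  (* [q] is the number of classes, and [exp K] bounds the product of the decoupling factors within
     one class. *)
  set (q := S a0); set (C := INR q * exp K).
  assert (Hq : 1 <= INR q) by (apply (le_INR 1); lia).
  assert (HE : 1 <= exp K) by (pose proof (exp_ineq1_le K); lra).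
  assert (HC : 1 <= C) by (unfold C; nra).
  exists C; split; [easy|].
  intros n a b Hper.
  set (P := trig_sq a b d).
  assert (Habs : forall k t, trig_abs (a k) (b k) (d k) t ^ 2 = P k t).
  { intros; apply pow2_sqrt, Rplus_le_le_0_compat; apply pow2_ge_0. }
  assert (EL : norm_L1l2 n a b d = diag_avg P n 0).
  { apply Tint_ext; intros; rewrite Rplus_0_r; f_equal; apply sumR_ext; intros; apply Habs. }
  assert (EI : norm_ind n a b d = ind_avg P n 0).
  { rewrite <- Tint_iter_ind_avg; apply Tint_iter_ext; intros.
    rewrite Rplus_0_r; f_equal; apply sumR_ext; intros; apply Habs. }
  rewrite EL, EI; clear EL EI.
  set (Q := fun r => on_class q r P).
  assert (HQc : forall r k t, continuous (Q r k) t) by (intros; apply class_sq_continuous).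
  assert (HQ0 : forall r k t, 0 <= Q r k t) by (intros; apply class_sq_nonneg).
  assert (HPc : forall k t, continuous (P k) t) by (intros; apply trig_sq_continuous).
  assert (HQP : forall r k t, Q r k t <= P k t).
  { intros r k t; unfold Q, on_class; destruct (_ =? _)%nat; [lra|].
    apply Rplus_le_le_0_compat; apply pow2_ge_0. }
  assert (EQ : (fun k t => sumR q (fun r => Q r k t)) = P).
  { do 2 (apply functional_extensionality; intros); apply sumR_on_class; unfold q; lia. }
  assert (Hcmp : forall r, ind_avg (Q r) n 0 <= exp K * diag_avg (Q r) n 0 /\
                           diag_avg (Q r) n 0 <= exp K * ind_avg (Q r) n 0).
  { intros r.
    destruct (ind_diag_compare (Q r) eps n) with (m := n) (c := 0) as [H1 H2]; auto; try lra.
    { intros m c Hm Hc; now apply (class_decouple_step d N a0 n r m a b c). }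
    assert (HEn : exp (sumR n eps) <= exp K) by (apply exp_mono, HK).
    assert (0 <= diag_avg (Q r) n 0).
    { apply Tint_nonneg; intros; [now apply diag_integrand_continuous|apply sqrt_pos]. }
    pose proof (exp_pos (sumR n eps)).
    (* Read off from [H2], whose left side is nonnegative. *)
    assert (0 <= ind_avg (Q r) n 0) by nra.
    split; (eapply Rle_trans; [eassumption|]); now apply Rmult_le_compat_r. }
  assert (Hind : ind_avg P n 0 <= C * diag_avg P n 0).
  { apply Rle_trans with (sumR q (fun r => ind_avg (Q r) n 0)).
    - pose proof (ind_avg_subadditive q Q n (fun _ => 0)) as H.
      rewrite EQ, sumR_zero in H; apply H; auto; intros; lra.
    - unfold C; rewrite Rmult_assoc, <- sumR_const; apply sumR_le; intros r _.
      eapply Rle_trans; [apply Hcmp|].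
      apply Rmult_le_compat_l; [lra|].
      (* Each class is dominated by the full family, so the sum over classes is at most [q] equal
         bounds. *)
      apply diag_avg_mono; auto; intros; apply Rplus_le_compat_r, sumR_le; auto. }
  assert (Hdiag : diag_avg P n 0 <= C * ind_avg P n 0).
  { apply Rle_trans with (sumR q (fun r => diag_avg (Q r) n 0)).
    - rewrite <- EQ; now apply diag_avg_subadditive.
    - unfold C; rewrite Rmult_assoc, <- sumR_const; apply sumR_le; intros r _.
      eapply Rle_trans; [apply Hcmp|].
      apply Rmult_le_compat_l; [lra|].
      apply ind_avg_mono; auto; lra. }
  split; [|easy].
  apply (Rmult_le_reg_l C); [lra|].
  rewrite <- Rmult_assoc, Rinv_r, Rmult_1_l by lra; easy.
Qed.
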